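(* Let $X,Y$ be locally compact Hausdorff spaces and let $\mathcal{E}$ be a proper, nondegenerate $C^*$-correspondence from $C_0(Y)$ to $C_0(X)$, with left action $\varphi$, that is $\sigma$-finitely generated and $\sigma$-projective as a right Hilbert $C_0(X)$-module, and let $\mathcal{V}$ be the Hermitian vector bundle with $\Gamma_0(\mathcal{V})\cong\mathcal{E}$. Consider the three bijections (described in the context) between: isomorphism classes of proper twisted $Y$-$X$-correspondences associated to $\mathcal{E}$; equivalence classes of normalizing atlases of $\mathcal{V}$ diagonalizing the left action; conjugacy classes of Cartan subalgebras of $\mathcal{K}(\mathcal{E})$ containing the image of $\varphi$. The triangle formed by these bijections commutes: for every proper twisted $Y$-$X$-correspondence $(Z,r,s,\mathcal{L})$ associated to $\mathcal{E}$, the Cartan subalgebra obtained from it directly (bijection (III)) and the Cartan subalgebra obtained by first passing to an atlas (bijection (I)) and then from the atlas to a Cartan subalgebra (bijection (II)) are conjugate.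
   Context: **$C^*$-correspondences.** A $C^*$-correspondence from $B$ to $A$ is a right Hilbert $A$-module $\mathcal{E}$ with a $*$-homomorphism $\varphi:B\to\mathcal{L}(\mathcal{E})$. Isomorphisms are inner-product preserving $A$-linear bijections intertwining left actions. Proper: $\varphi(B)\subset\mathcal{K}(\mathcal{E})$. Nondegenerate: $\varphi(B)\mathcal{E}$ has dense linear span. A Hilbert $C_0(X)$-module is $\sigma$-finitely generated and $\sigma$-projective if it is isomorphic to $\Gamma_0(\mathcal{V})$, the continuous sections vanishing at infinity of a Hermitian complex vector bundle $\mathcal{V}$ of finite, locally constant rank $n_x$ over an open subset of $X$. We identify $\mathcal{E}=\Gamma_0(\mathcal{V})$; $T_x$ is the operator on $\mathcal{V}_x$ induced by $T\in\mathcal{K}(\mathcal{E})$. **Twisted correspondences.** A proper twisted $Y$-$X$-correspondence $(Z,r,s,\mathcal{L})$ consists of a locally compact Hausdorff space $Z$, a local homeomorphism $s:Z\to X$ proper onto its image (hence a covering map onto its image with finite fibers), a proper continuous map $r:Z\to Y$, and a Hermitian line bundle $\mathcal{L}$ over $Z$. Isomorphism: a homeomorphism $\phi:Z\to Z'$ with $s'\circ\phi=s$, $r'\circ\phi=r$, $\phi^*\mathcal{L}'\cong\mathcal{L}$. $\Gamma_0(Z,r,s,\mathcal{L})$ is $\Gamma_0(\mathcal{L})$ with $\langle\xi,\eta\rangle(x)=\sum_{s(z)=x}\langle\xi(z),\eta(z)\rangle_{\mathcal{L}}$, $(\xi f)(z)=\xi(z)f(s(z))$, $(\varphi(g)\xi)(z)=g(r(z))\xi(z)$.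 Associated to $\mathcal{E}$: $\Gamma_0(Z,r,s,\mathcal{L})\cong\mathcal{E}$ as $C^*$-correspondences. **Atlases.** An atlas $(U_i,h_i)$ of $\mathcal{V}$ consists of fibrewise isometric trivializations $h_i:U_i\times\mathbb{C}^n\to\mathcal{V}|_{U_i}$ over an open cover, with $g_{ij}(x)=h_i^{-1}\circ h_j(x,\cdot)$. $\mathcal{U}(N_{D_n})$ is the group of products of a unitary diagonal and a permutation matrix in $M_n$. Normalizing: $g_{ij}(x)\in\mathcal{U}(N_{D_{n_x}})$ always. Diagonalizing the left action: each $U_i$ has compact closure and each $h_i(x,e_k)$ is an eigenvector of $\varphi(f)_x$ for all $f\in C_0(Y)$. Equivalence of two such atlases (after passing to a common cover): there are continuous $r_i$ on $U_i$ with $r_i(x)\in\mathcal{U}(N_{D_{n_x}})$, $g'_{ij}=r_i^{-1}g_{ij}r_j$, such that $\mathcal{V}_x\ni v\mapsto h_i'(x,r_i(x)^{-1}h_i^{-1}(v))$ intertwines the left actions. **Cartan subalgebras.** A Cartan subalgebra of a $C^*$-algebra $A$ is a maximal abelian subalgebra $D$ containing an approximate unit of $A$, whose normalizers generate $A$, and admitting a faithful conditional expectation $A\to D$. $D,D'\subset\mathcal{K}(\mathcal{E})$ are conjugate if an automorphism of $\mathcal{E}$ (inner-product preserving $C_0(X)$-linear bijection commuting with the left action) induces an automorphism of $\mathcal{K}(\mathcal{E})$ mapping $D$ to $D'$. **(I) Correspondence $\to$ atlas.** An isomorphism $\Gamma_0(Z,r,s,\mathcal{L})\cong\mathcal{E}$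 identifies $\mathcal{V}_x$ with $\bigoplus_{z\in s^{-1}(x)}\mathcal{L}_z$. Cover the base by relatively compact open $U_i$ with $s^{-1}(U_i)=\bigsqcup_kU_i^{(k)}$, $U_i^{(k)}\cong U_i$ via $s$, and unit sections $t_{ik}$ of $\mathcal{L}$ on $U_i^{(k)}$; $h_i(x,e_k)$ is the vector corresponding to $t_{ik}(z)$, $z\in U_i^{(k)}$, $s(z)=x$. **(II) Atlas $\to$ Cartan.** $D=\{T\in\mathcal{K}(\mathcal{E}):T_x$ is diagonal in the basis $(h_i(x,e_k))_k$ for all $i$, $x\in U_i\}$. **(III) Correspondence $\to$ Cartan.** The subalgebra of $\mathcal{K}(\mathcal{E})$ corresponding, under an isomorphism $\mathcal{E}\cong\Gamma_0(Z,r,s,\mathcal{L})$, to $\{\Theta_f:f\in C_0(Z)\}$, where $(\Theta_f\xi)(z)=f(z)\xi(z)$. *)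

(* Defs.v *)
From HB Require Import structures.
From mathcomp Require Import all_boot all_order all_fingroup all_algebra.
From mathcomp Require Import all_classical all_reals all_analysis.
From mathcomp Require Import complex.

Set Implicit Arguments.
Unset Strict Implicit.
Unset Printing Implicit Defensive.

Import Order.TTheory GRing.Theory Num.Theory.
Import numFieldNormedType.Exports.

Local Open Scope classical_set_scope.
Local Open Scope ring_scope.

(* Inner products are conjugate-linear in the first variable and linear in    *)
(* the second one, as usual for right Hilbert modules.                        *)

(* The field of complex numbers.  The type ascription is what gives it the    *)
(* topology and the norm that the library puts on a [numClosedFieldType].     *)
Definition Cplx (R : realType) : numClosedFieldType := R[i].

Definition cabs (R : realType) (z : Cplx R) : R := complex.Re `|z|.

(** * Functions vanishing at infinity *)

(* [f] is an element of C_0(X).  The algebra C_0(X) is handled as a predicate *)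
(* on functions: actions of C_0(X) are total in the function argument, and    *)
(* their axioms only concern elements of C_0(X).                              *)
Definition C0 (R : realType) (X : topologicalType) (f : X -> Cplx R) : Prop :=
  continuous f /\ forall e : R, 0 < e -> compact [set x | e <= cabs (f x)].

Definition supnorm (R : realType) (X : Type) (f : X -> Cplx R) : R :=
  sup (range (fun x => cabs (f x))).

(** * Hilbert modules and C*-correspondences *)

Record hilbert_module (R : realType) (X : topologicalType) := HilbertModule {
  hm_sort :> lmodType (Cplx R);
  inner : hm_sort -> hm_sort -> X -> Cplx R;
  ract : hm_sort -> (X -> Cplx R) -> hm_sort;
  inner_C0 : forall u v, C0 (inner u v);
  innerPr : forall a u v w x,
    inner u (a *: v + w) x = a * inner u v x + inner u w x;
  innerC : forall u v x, inner v u x = (inner u v x)^*;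
  inner_ge0 : forall u x, 0 <= inner u u x;
  inner_eq0 : forall u, (forall x, inner u u x = 0) -> u = 0;
  inner_ract : forall u v f x, C0 f -> inner u (ract v f) x = inner u v x * f x;
  ractPl : forall a u v f, C0 f -> ract (a *: u + v) f = a *: ract u f + ract v f;
  ractPr : forall a u f g, C0 f -> C0 g ->
    ract u (fun x => a * f x + g x) = a *: ract u f + ract u g;
  ractM : forall u f g, C0 f -> C0 g ->
    ract u (fun x => f x * g x) = ract (ract u f) g;
  hm_complete : forall u_ : nat -> hm_sort,
    let nrm u := Num.sqrt (supnorm (inner u u)) in
    (forall e : R, 0 < e -> exists N, forall m n, (N <= m)%N -> (N <= n)%N ->
       nrm (u_ m - u_ n) <= e) ->
    exists l, forall e : R, 0 < e -> exists N, forall n, (N <= n)%N ->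
       nrm (u_ n - l) <= e
}.

Section Operators.
Variables (R : realType) (X : topologicalType) (E : hilbert_module R X).
Implicit Types (S T : E -> E) (A D : set (E -> E)).

Definition hmnorm (u : E) : R := Num.sqrt (supnorm (inner u u)).

(* The operator norm of [T] is at most [c]. *)
Definition opnorm_le T (c : R) : Prop := forall u, hmnorm (T u) <= c * hmnorm u.

Definition is_adjoint T T' : Prop :=
  forall u v x, inner (T u) v x = inner u (T' v) x.

Definition adjointable T : Prop := exists T', is_adjoint T T'.

Definition op_ge0 T : Prop := forall u x, 0 <= inner u (T u) x.

(* \sum_(p in s) \theta_(p.1, p.2), where \theta_(u, v) w = u <v, w>. *)
Definition finite_rank_op (s : seq (E * E)) : E -> E :=
  fun w => \sum_(p <- s) ract p.1 (inner p.2 w).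

(* The algebra K(E). *)
Definition compact_op : set (E -> E) := [set T | adjointable T /\
  forall e : R, 0 < e -> exists s, opnorm_le (T \- finite_rank_op s) e].

(* Norm-closed *-subalgebras of the algebra L(E) of adjointable operators. *)
Record Cstar_subalgebra D : Prop := CstarSubalgebra {
  csub_adjointable : forall T, D T -> adjointable T;
  csub0 : D (fun=> 0);
  csubP : forall (a : Cplx R) T S, D T -> D S -> D (a \*: T \+ S);
  csubM : forall T S, D T -> D S -> D (T \o S);
  csub_adj : forall T T', D T -> is_adjoint T T' -> D T';
  csub_closed : forall T, adjointable T ->
    (forall e : R, 0 < e -> exists2 S, D S & opnorm_le (T \- S) e) -> D T
}.

Definition pairwise_commuting D : Prop :=
  forall S T, D S -> D T -> S \o T = T \o S.

Definition maximal_abelian A D : Prop :=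
  [/\ Cstar_subalgebra D, D `<=` A, pairwise_commuting D &
      forall D', Cstar_subalgebra D' -> D' `<=` A -> pairwise_commuting D' ->
        D `<=` D' -> D' = D].

Definition contains_approximate_unit A D : Prop :=
  exists (J : Type) (le : J -> J -> Prop) (e_ : J -> E -> E),
  [/\ inhabited J, (forall j, le j j), (forall i j k, le i j -> le j k -> le i k) &
      forall i j, exists k, le i k /\ le j k] /\
  [/\ (forall j, D (e_ j)),
      (forall j, op_ge0 (e_ j) /\ opnorm_le (e_ j) 1),
      (forall i j, le i j -> op_ge0 (e_ j \- e_ i)) &
      forall T, A T -> forall e : R, 0 < e -> exists j0, forall j, le j0 j ->
        opnorm_le (T \o e_ j \- T) e /\ opnorm_le (e_ j \o T \- T) e].

Definition normalizer_set A D : set (E -> E) := [set N | A N /\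
  forall N' T, is_adjoint N N' -> D T -> D (N \o T \o N') /\ D (N' \o T \o N)].

(* [A] is the smallest C*-algebra containing [G]. *)
Definition Cstar_generates A (G : set (E -> E)) : Prop :=
  G `<=` A /\ forall B, Cstar_subalgebra B -> G `<=` B -> A `<=` B.

Record faithful_expectation A D (P : (E -> E) -> E -> E) : Prop :=
  FaithfulExpectation {
  exp_in : forall T, A T -> D (P T);
  exp_id : forall T, D T -> P T = T;
  exp_linear : forall (a : Cplx R) T S, A T -> A S ->
    P (a \*: T \+ S) = a \*: P T \+ P S;
  exp_bimodule : forall T d d', A T -> D d -> D d' ->
    P (d \o T \o d') = d \o P T \o d';
  exp_ge0 : forall T, A T -> op_ge0 T -> op_ge0 (P T);
  exp_contractive : forall T (c : R), A T -> opnorm_le T c -> opnorm_le (P T) c;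
  exp_faithful : forall T T', A T -> is_adjoint T T' ->
    P (T' \o T) = (fun=> 0) -> T = (fun=> 0)
}.

Record Cartan_subalgebra A D : Prop := CartanSubalgebra {
  cartan_masa : maximal_abelian A D;
  cartan_unit : contains_approximate_unit A D;
  cartan_regular : Cstar_generates A (normalizer_set A D);
  cartan_expectation : exists P, faithful_expectation A D P
}.

End Operators.

(* C*-correspondences from C_0(Y) to C_0(X); [lact] is the left action. *)
Record correspondence (R : realType) (Y X : topologicalType) :=
  Correspondence {
  corr_hm :> hilbert_module R X;
  lact : (Y -> Cplx R) -> corr_hm -> corr_hm;
  lact_adj : forall g, C0 g -> is_adjoint (lact g) (lact (fun y => (g y)^*));
  lactP : forall (a : Cplx R) f g u, C0 f -> C0 g ->
    lact (fun y => a * f y + g y) u = a *: lact f u + lact g u;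
  lactM : forall f g u, C0 f -> C0 g ->
    lact (fun y => f y * g y) u = lact f (lact g u)
}.

Section Correspondences.
Variables (R : realType) (Y X : topologicalType) (E : correspondence R Y X).

Definition proper_corr : Prop := forall g, C0 g -> compact_op (lact (c := E) g).

Definition nondegenerate_corr : Prop :=
  forall (u : E) (e : R), 0 < e ->
    exists (n : nat) (g : 'I_n -> Y -> Cplx R) (v : 'I_n -> E),
      (forall k, C0 (g k)) /\ hmnorm (u - \sum_k lact (g k) (v k)) <= e.

Definition contains_left_action (D : set (E -> E)) : Prop :=
  forall g, C0 g -> D (lact g).

Record corr_automorphism (W : E -> E) : Prop := CorrAutomorphism {
  aut_bij : bijective W;
  aut_linear : linear W;
  aut_inner : forall u v x, inner (W u) (W v) x = inner u v x;
  aut_ract : forall u f, C0 f -> W (ract u f) = ract (W u) f;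
  aut_lact : forall u g, C0 g -> W (lact g u) = lact g (W u)
}.

(* [D'] is the image of [D] under T |-> W T W^-1. *)
Definition conjugate_subalgebras (D D' : set (E -> E)) : Prop :=
  exists W, corr_automorphism W /\
    D' = [set T' : E -> E | exists2 T, D T & T' \o W = W \o T].

End Correspondences.

(** * Hermitian vector bundles *)

Section Trivializations.
Variables (R : realType) (B : topologicalType) (F : B -> lmodType (Cplx R)).
Variables (tot : topologicalType) (pt : {b : B & F b} -> tot).

(* [h] is a homeomorphism, linear on fibres, from U x C^n onto the restriction *)
(* to the open set [U] of the family [F] with total space [tot].               *)
Definition trivialization (n : nat) (U : set B)
    (h : forall b, 'cV[Cplx R]_n -> F b) : Prop :=
  let H p := pt (existT _ p.1 (h p.1 p.2)) in
  [/\ open U,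
      (forall b, U b -> linear (h b) /\ bijective (h b)),
      {within U `*` setT, continuous H} &
      forall O : set (B * 'cV[Cplx R]_n), open O -> O `<=` U `*` setT ->
        open (H @` O)].

End Trivializations.

(* [fib b] is the fibre over [b]; [tot] is the total space, whose points are *)
(* labelled by [pt].  The rank is finite and locally constant by local        *)
(* triviality.                                                                *)
Record herm_bundle (R : realType) (B : topologicalType) := HermBundle {
  fib : B -> lmodType (Cplx R);
  tot : topologicalType;
  pt : {b : B & fib b} -> tot;
  hip : forall b, fib b -> fib b -> Cplx R;
  pt_bij : bijective pt;
  hipP : forall b (a : Cplx R) (u v w : fib b),
    hip u (a *: v + w) = a * hip u v + hip u w;
  hipC : forall b (u v : fib b), hip v u = (hip u v)^*;
  hip_gt0 : forall b (u : fib b), u != 0 -> 0 < hip u u;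
  (* local triviality, and continuity of the Gram matrix of local frames *)
  local_triv : forall b, exists n U (h : forall b, 'cV[Cplx R]_n -> fib b),
    [/\ U b, trivialization pt U h &
        forall v w, {within U, continuous (fun b => hip (h b v) (h b w))}]
}.

Definition bundle_section (R : realType) (B : topologicalType)
    (V : herm_bundle R B) :=
  forall b, fib V b.

Arguments pt {R B} V _ : rename.

Section Bundles.
Variables (R : realType) (B : topologicalType) (V : herm_bundle R B).

Definition fibnorm b (v : fib V b) : R := Num.sqrt (complex.Re (hip v v)).

Definition continuous_section (U : set B) (xi : bundle_section V) : Prop :=
  {within U, continuous (fun b => pt V (existT _ b (xi b)))}.

Definition Gamma0 (xi : bundle_section V) : Prop :=
  continuous_section setT xi /\
  forall e : R, 0 < e -> compact [set b | e <= fibnorm (xi b)].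

Definition line_bundle : Prop :=
  forall b, exists2 v : fib V b, v != 0 & forall w, exists a : Cplx R, w = a *: v.

End Bundles.

(* [Phi] is an isomorphism of Hilbert C_0(X)-modules from [E] onto            *)
(* \Gamma_0(V), where [V] is a bundle over [Z] and C_0(X) acts through        *)
(* s : Z -> X (with finite fibres):                                           *)
(*   <xi, eta> x = \sum_(s z = x) <xi z, eta z>, (xi f) z = f (s z) xi z.     *)
(* For [s] the inclusion of an open subset of [X], this is the usual          *)
(* \Gamma_0 of a bundle over that subset.                                     *)
Record Gamma0_iso (R : realType) (X Z : topologicalType)
    (E : hilbert_module R X) (s : Z -> X) (V : herm_bundle R Z)
    (Phi : E -> bundle_section V) : Prop := Gamma0Iso {
  giso_Gamma0 : forall u, Gamma0 (Phi u);
  giso_surj : forall xi, Gamma0 xi -> exists u, Phi u = xi;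
  giso_inj : injective Phi;
  giso_linear : forall (a : Cplx R) u v z,
    Phi (a *: u + v) z = a *: Phi u z + Phi v z;
  giso_inner : forall u v x,
    inner u v x = \sum_(z \in s @^-1` [set x]) hip (Phi u z) (Phi v z);
  giso_ract : forall u f z, C0 f -> Phi (ract u f) z = f (s z) *: Phi u z
}.

(** * Twisted correspondences *)

Definition local_homeomorphism (Z X : topologicalType) (s : Z -> X) : Prop :=
  continuous s /\
  forall z, exists U : set Z, [/\ open U, U z, set_inj U s &
    forall O, open O -> O `<=` U -> open (s @` O)].

(* The compact subsets of the subspace s(Z) are the compact subsets of X      *)
(* contained in s(Z).                                                         *)
Definition proper_onto_image (Z X : topologicalType) (s : Z -> X) : Prop :=
  forall K, compact K -> K `<=` range s -> compact (s @^-1` K).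

Definition proper_map (Z Y : topologicalType) (r : Z -> Y) : Prop :=
  continuous r /\ forall K, compact K -> compact (r @^-1` K).

Record twisted_correspondence (R : realType) (Y X : topologicalType) :=
  TwistedCorrespondence {
  tc_space : topologicalType;
  tc_r : tc_space -> Y;
  tc_s : tc_space -> X;
  tc_line : herm_bundle R tc_space;
  tc_hausdorff : hausdorff_space tc_space;
  tc_locally_compact : locally_compact [set: tc_space];
  tc_s_local_homeo : local_homeomorphism tc_s;
  tc_s_proper : proper_onto_image tc_s;
  tc_r_proper : proper_map tc_r;
  tc_line_bundle : line_bundle tc_line
}.

Arguments tc_r {R Y X} Z _ : rename.
Arguments tc_s {R Y X} Z _ : rename.

(* [Psi] is an isomorphism of C*-correspondences from [E] onto               *)
(* \Gamma_0(Z, r, s, L).                                                      *)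
Definition tc_iso (R : realType) (Y X : topologicalType)
    (E : correspondence R Y X) (Z : twisted_correspondence R Y X)
    (Psi : E -> bundle_section (tc_line Z)) : Prop :=
  Gamma0_iso (tc_s Z) Psi /\
  forall g u z, C0 g -> Psi (lact g u) z = g (tc_r Z z) *: Psi u z.

Definition associated (R : realType) (Y X : topologicalType)
    (E : correspondence R Y X) (Z : twisted_correspondence R Y X) : Prop :=
  exists Psi : E -> bundle_section (tc_line Z), tc_iso Psi.

(** * Atlases *)

(* h_i(b, -) is only meaningful for b in U_i. *)
Record atlas (R : realType) (B : topologicalType) (V : herm_bundle R B) :=
  Atlas {
  chart_index : Type;
  chart_dom : chart_index -> set B;
  chart_rank : chart_index -> nat;
  chart : forall i b, 'cV[Cplx R]_(chart_rank i) -> fib V b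
}.

Arguments chart_dom {R B V} A i _ : rename.
Arguments chart_rank {R B V} A i : rename.
Arguments chart {R B V} A i b _ : rename.

Definition basis_vec (R : realType) (n : nat) (k : 'I_n) : 'cV[Cplx R]_n :=
  delta_mx k 0.

Section Atlases.
Variables (R : realType) (B : topologicalType) (V : herm_bundle R B).
Variable A : atlas V.

Record is_atlas : Prop := IsAtlas {
  atlas_cover : forall b, exists i, chart_dom A i b;
  atlas_triv : forall i, trivialization (pt V) (chart_dom A i) (chart A i);
  atlas_isometric : forall i b v w, chart_dom A i b ->
    hip (chart A i b v) (chart A i b w) = \sum_k (v k 0)^* * w k 0
}.

(* U(N_(D_n)).  Charts with intersecting domains have equal ranks, but only   *)
(* provably so; hence the cast.                                               *)
Definition unitary_monomial (m n : nat) (g : 'M[Cplx R]_(m, n)) : Prop :=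
  exists (e : m = n) (d : 'rV[Cplx R]_m) (p : 'S_m),
    (forall k, `|d 0 k| = 1) /\ g = castmx (erefl m, e) (diag_mx d *m perm_mx p).

(* g_ij(b) = h_i(b, -)^-1 \o h_j(b, -). *)
Definition normalizing_atlas : Prop :=
  forall i j b, chart_dom A i b -> chart_dom A j b ->
    exists g : 'M[Cplx R]_(chart_rank A i, chart_rank A j),
      (forall v, chart A j b v = chart A i b (g *m v)) /\
      unitary_monomial g.

End Atlases.

Section AtlasesModule.
Variables (R : realType) (Y X : topologicalType) (E : correspondence R Y X).
Variables (U : set X) (V : herm_bundle R U) (Phi : E -> bundle_section V).
Implicit Type A : atlas V.

(* [Tb] is the operator T_b induced by [T] on the fibre at [b], where [E] is  *)
(* identified with \Gamma_0(V) through [Phi].                                 *)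
Definition fibre_op (T : E -> E) (b : U) (Tb : fib V b -> fib V b) : Prop :=
  forall u, Phi (T u) b = Tb (Phi u b).

(* T_b is diagonal in the basis (h_i(b, e_k))_k. *)
Definition diagonal_at A (T : E -> E) (i : chart_index A) (b : U) : Prop :=
  exists Tb, fibre_op T Tb /\
    forall k, exists a : Cplx R,
      Tb (chart A i b (basis_vec R k)) =
      a *: chart A i b (basis_vec R k).

(* Closures are taken in the base of the bundle. *)
Definition diagonalizing_atlas A : Prop :=
  (forall i, compact (closure (chart_dom A i))) /\
  forall g i b, C0 g -> chart_dom A i b -> diagonal_at (lact g) i b.

Definition normalizing_diagonalizing_atlas A : Prop :=
  [/\ is_atlas A, normalizing_atlas A & diagonalizing_atlas A].

(** From twisted correspondences to atlases *)

(* Under the identification of V_b with \bigoplus_(s z = b) L_z given by      *)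
(* [Phi] and [Psi], [v] is the vector with component [l] at [z] and           *)
(* components 0 at the other points of the fibre of [s] over [b].             *)
Definition corresponds (Z : twisted_correspondence R Y X)
    (Psi : E -> bundle_section (tc_line Z)) (b : U) (v : fib V b)
    (z : tc_space Z) (l : fib (tc_line Z) z) : Prop :=
  exists u, [/\ Phi u b = v, Psi u z = l &
    forall z', tc_s Z z' = set_val b -> z' <> z -> Psi u z' = 0].

(* [slice i k] is U_i^(k).  As [s] is a local homeomorphism, it restricts to a *)
(* homeomorphism from U_i^(k) to U_i as soon as this restriction is bijective. *)
Record constructed_atlas (Z : twisted_correspondence R Y X)
    (Psi : E -> bundle_section (tc_line Z)) A
    (slice : forall i : chart_index A, 'I_(chart_rank A i) -> set (tc_space Z))
    (t : forall i : chart_index A,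
       'I_(chart_rank A i) -> bundle_section (tc_line Z)) :
    Prop := ConstructedAtlas {
  ca_cover : forall b, exists i, chart_dom A i b;
  ca_open : forall i, open (chart_dom A i);
  ca_precompact : forall i, compact (closure (chart_dom A i));
  ca_slice_open : forall i k, open (slice i k);
  ca_slice_bij : forall i k,
    set_bij (slice i k) (set_val @` chart_dom A i) (tc_s Z);
  ca_slice_disj : forall i k k' z, slice i k z -> slice i k' z -> k = k';
  ca_preimage : forall i,
    tc_s Z @^-1` (set_val @` chart_dom A i) = \bigcup_k slice i k;
  ca_continuous : forall i k, continuous_section (slice i k) (t i k);
  ca_unit : forall i k z, slice i k z -> hip (t i k z) (t i k z) = 1;
  ca_linear : forall i b, chart_dom A i b -> linear (chart A i b);
  ca_chart : forall i b k z, chart_dom A i b -> slice i k z ->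
    tc_s Z z = set_val b ->
    corresponds Psi (chart A i b (basis_vec R k)) (t i k z)
}.

Definition atlas_of_tc (Z : twisted_correspondence R Y X) A : Prop :=
  exists (Psi : E -> bundle_section (tc_line Z))
    (slice : forall i : chart_index A, 'I_(chart_rank A i) -> set (tc_space Z))
    (t : forall i : chart_index A,
       'I_(chart_rank A i) -> bundle_section (tc_line Z)),
    tc_iso Psi /\ constructed_atlas Psi slice t.

(** From atlases to Cartan subalgebras *)

Definition cartan_of_atlas A : set (E -> E) := [set T | compact_op T /\
  forall i b, chart_dom A i b -> diagonal_at T i b].

End AtlasesModule.

(** From twisted correspondences to Cartan subalgebras *)

Definition multiplication_algebra (R : realType) (Y X : topologicalType)
    (E : correspondence R Y X) (Z : twisted_correspondence R Y X)
    (Psi : E -> bundle_section (tc_line Z)) : set (E -> E) :=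
  [set T | exists2 f, C0 f & forall u z, Psi (T u) z = f z *: Psi u z].

Definition cartan_of_tc (R : realType) (Y X : topologicalType)
    (E : correspondence R Y X) (Z : twisted_correspondence R Y X)
    (D : set (E -> E)) : Prop :=
  exists2 Psi : E -> bundle_section (tc_line Z),
    tc_iso Psi & D = multiplication_algebra Psi.

(* Main.v *)
(* An isomorphism Psi of E onto the sections of the line bundle L over Z turns
   E into a space of functions on Z, and everything reduces to the algebra of
   multiplication operators M_f, f in C_0(Z).  As s is a local homeomorphism,
   every z has a section of norm 1 at z (a "peak") supported in a set on which s
   is injective.  Hence E_x is the orthogonal sum of the lines L_z over
   s z = x, and T |-> (the diagonal coefficients of T in this decomposition) is
   the conditional expectation onto {M_f}.  A compact operator that is diagonal
   at every point is a multiplication operator by a C_0 function.  This gives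
   maximality of {M_f}, and also shows that the Cartan algebra of the atlas
   built from Psi is {M_f} on the nose, the frame vectors of that atlas being
   unit vectors of the lines L_z.  Two isomorphisms Psi, Psi' then differ by the
   automorphism Psi'^-1 Psi of E, which conjugates the two algebras. *)

From Pilot Require Import Defs.
From mathcomp Require Import all_boot all_order all_fingroup all_algebra.
From mathcomp Require Import all_classical all_reals all_analysis.
From mathcomp Require Import complex.
From mathcomp Require Import lra ring.
(* [ract] is also a name of fingroup. *)
Import Pilot.Defs.

Set Implicit Arguments.
Unset Strict Implicit.
Unset Printing Implicit Defensive.

Import Order.TTheory GRing.Theory Num.Theory.
Import numFieldNormedType.Exports.

Local Open Scope classical_set_scope.
Local Open Scope ring_scope.

(** Two obstacles shape the proof. The norm of [E] is a supremum over x of sums over the fibres of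
    [s]; these are finite but may have unbounded cardinality, so a section that is uniformly small
    on Z may have a large norm in [E]. Norms of elements are therefore estimated through elements
    supported where [s] is injective, whose norm is governed by their fibre norms, or through
    functions constant along the fibres. Multiplication operators are harmless: a bound on the
    function bounds the operator. Moreover the fibre E_x is never formed. Equality in it is the
    vanishing of the seminorm [ptnorm] of a difference, and Cauchy-Schwarz shows that adjointable
    operators preserve the null vectors of this seminorm. So T_x is handled through elements of [E]
    that agree over x. The same device compares [Phi] with [Psi], whose common ground is the inner
    product of [E]. Peaks are chosen point by point, with no continuity in the point; continuity of
    diagonal coefficients is recovered by comparison with one fixed peak nearby. *)

Lemma le_eps0 (R : realType) (a c : R) : 0 <= c ->
  (forall e : R, 0 < e -> a <= e * c) -> a <= 0.
Proof.
move=> c0 H; rewrite leNgt; apply/negP => a0.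
have c1 : 0 < c + 1 by rewrite ltr_wpDl.
(* The denominator is [c + 1] because [c] may be zero; the same device recurs below with norms in
   place of [c]. *)
have := H (a / 2 / (c + 1)); rewrite !divr_gt0// => /(_ isT).
have ac : a / 2 / (c + 1) * c <= a / 2.
  by rewrite -mulrA ler_piMr ?divr_ge0 ?(ltW a0)// mulrC ler_pdivrMr// mul1r lerDl.
by move=> /le_trans/(_ ac); lra.
Qed.

(** * Complex numbers and functions vanishing at infinity *)

Section ComplexModulus.
Variable R : realType.
Implicit Types z w : Cplx R.

Lemma normC_cabs z : `|z| = (cabs z)%:C%C.
Proof. by rewrite /cabs RRe_real// ger0_real. Qed.

Lemma cabs_ge0 z : 0 <= cabs z.
Proof. by rewrite -lecR -normC_cabs normr_ge0. Qed.

Lemma cabs_real (r : R) : cabs (r%:C%C : Cplx R) = `|r|.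
Proof. by rewrite /cabs normc_def /= expr0n addr0 sqrtr_sqr. Qed.

Lemma cabs0 : cabs (0 : Cplx R) = 0.
Proof. by rewrite /cabs normr0. Qed.

Lemma cabs_eq0 z : (cabs z == 0) = (z == 0).
Proof.
rewrite -[z == 0]normr_eq0 normC_cabs.
by apply/eqP/eqP => [->//|/complexI].
Qed.

Lemma cabsM z w : cabs (z * w) = cabs z * cabs w.
Proof. by apply: complexI; rewrite rmorphM /= -!normC_cabs normrM. Qed.

Lemma cabsD z w : cabs (z + w) <= cabs z + cabs w.
Proof. by rewrite -lecR rmorphD /= -!normC_cabs ler_normD. Qed.

Lemma cabsN z : cabs (- z) = cabs z.
Proof. by rewrite /cabs normrN. Qed.

Lemma cabs_conj z : cabs z^* = cabs z.
Proof. by rewrite /cabs norm_conjC. Qed.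

Lemma cabs_sum (I : Type) (s : seq I) (F : I -> Cplx R) :
  cabs (\sum_(i <- s) F i) <= \sum_(i <- s) cabs (F i).
Proof.
elim: s => [|i s IH]; first by rewrite !big_nil cabs0.
by rewrite !big_cons (le_trans (cabsD _ _))// lerD2l.
Qed.

Lemma mul_conjC z : z^* * z = ((cabs z) ^+ 2)%:C%C.
Proof. by rewrite mulrC -normCK normC_cabs rmorphXn. Qed.

(** The norm of [Cplx R] takes its values in [Cplx R] itself; this form of convergence has real
    moduli and real radii. *)
Lemma cvg_cabsP (T : Type) (F : set_system T) {FF : Filter F} (f : T -> Cplx R)
    (l : Cplx R) :
  f @ F --> l <-> forall e : R, 0 < e -> \forall x \near F, cabs (f x - l) < e.
Proof.
split=> [fl e e0|fl].
  have e0' : 0 < (e%:C%C : Cplx R) by rewrite ltcR.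
  have /cvgrPdist_lt/(_ _ e0') := fl.
  apply: filterS => x; rewrite distrC normC_cabs ltcR; exact.
apply/cvgrPdist_lt => e e0.
have eE : e = (complex.Re e)%:C%C by rewrite RRe_real// gtr0_real.
have e0' : 0 < complex.Re e by rewrite -ltcR -eE.
apply: filterS (fl _ e0') => x; rewrite distrC normC_cabs eE ltcR; exact.
Qed.

Lemma cabs_dist z w : `|cabs z - cabs w| <= cabs (z - w).
Proof.
have := cabsD (z - w) w; have := cabsD (w - z) z; rewrite !subrK.
by rewrite -[w - z]opprB cabsN ler_norml; lra.
Qed.

Lemma cabs_continuous : continuous (@cabs R).
Proof.
move=> z; apply/(@cvgrPdist_lt _ _ _ _ (nbhs_filter z)) => e e0.
have /(@cvg_cabsP _ _ (nbhs_filter z))/(_ _ e0) : (fun x => x) @ z --> z by exact: cvg_id.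
apply: filterS => x xz; apply: le_lt_trans xz; rewrite distrC.
exact: cabs_dist.
Qed.

Lemma conj_continuous : continuous (fun z : Cplx R => z^*).
Proof.
move=> z; apply/(@cvg_cabsP _ _ (nbhs_filter z)) => e e0.
have /(@cvg_cabsP _ _ (nbhs_filter z))/(_ _ e0) : (fun x => x) @ z --> z by exact: cvg_id.
by apply: filterS => x; rewrite -rmorphB cabs_conj.
Qed.

Lemma realC_continuous : continuous (fun r : R => r%:C%C : Cplx R).
Proof.
move=> r; apply/cvg_cabsP => e e0.
have /cvgrPdist_lt/(_ _ e0) : (fun x => x) @ r --> r by exact: cvg_id.
by apply: filterS => x; rewrite -rmorphB cabs_real distrC.
Qed.

Lemma Re_le_cabs z : `|complex.Re z| <= cabs z.
Proof. by rewrite -lecR -normC_cabs normc_ge_Re. Qed.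

Lemma Re_continuous : continuous (fun z : Cplx R => complex.Re z).
Proof.
move=> z; apply/(@cvgrPdist_lt _ _ _ _ (nbhs_filter z)) => e e0.
have /(@cvg_cabsP _ _ (nbhs_filter z))/(_ _ e0) : (fun x => x) @ z --> z by exact: cvg_id.
apply: filterS => x; apply: le_lt_trans.
by rewrite -raddfB/= (le_trans (Re_le_cabs _))// -[X in cabs X]opprB cabsN.
Qed.

End ComplexModulus.

(** * Domination and approximation criteria for vanishing at infinity *)

Section Vanishing.
Variables (R : realType) (X : topologicalType).
Implicit Types (f g : X -> Cplx R) (h k : X -> R).

Definition vanishing h : Prop :=
  continuous h /\ forall e : R, 0 < e -> compact [set x | e <= h x].

Lemma closed_superlevel h e : continuous h -> closed [set x | e <= h x].
Proof.
by move=> hc; apply: (@closed_comp _ _ h [set y | e <= y]) => [x _|];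
  [exact: hc|exact: closed_ge].
Qed.

(** The set [e <= h] is closed in the compact set [e / 2 <= k], for the [k] that works at precision
    [e / 2]. *)
Lemma vanishing_approx h : continuous h ->
  (forall e : R, 0 < e -> exists2 k, vanishing k & forall x, h x <= e + k x) ->
  vanishing h.
Proof.
move=> hc H; split=> // e e0.
have e20 : 0 < e / 2 by rewrite divr_gt0.
have [k [_ kv] hk] := H _ e20.
apply: subclosed_compact (kv _ e20) _; first exact: closed_superlevel.
by move=> x /= ex; rewrite -(lerD2l (e / 2)) -splitr (le_trans ex).
Qed.

Lemma vanishing_le h k : continuous h -> vanishing k ->
  (forall x, h x <= k x) -> vanishing h.
Proof.
move=> hc kv hk; apply: vanishing_approx => // e e0; exists k => // x.
by rewrite (le_trans (hk x))// lerDr ltW.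
Qed.

Lemma vanishing0 : vanishing (fun=> 0).
Proof.
split=> [|e e0]; first exact: cst_continuous.
rewrite (_ : mkset _ = set0); first exact: compact0.
by rewrite -subset0 => x /=; rewrite leNgt e0.
Qed.

Lemma vanishingZ (c : R) h : 0 <= c -> vanishing h -> vanishing (fun x => c * h x).
Proof.
rewrite le_eqVlt => /predU1P[<- _|c0 [hc hv]].
  by under eq_fun do rewrite mul0r; exact: vanishing0.
split=> [x|e e0]; first by apply: cvgM; [exact: cvg_cst|exact: hc].
rewrite (_ : mkset _ = [set x | e / c <= h x]); first by apply/hv/divr_gt0.
by apply/seteqP; split=> x /=; rewrite ler_pdivrMr// mulrC.
Qed.

Lemma vanishingD h k : vanishing h -> vanishing k -> vanishing (fun x => h x + k x).
Proof.
move=> [hc hv] [kc kv]; have hkc : continuous (fun x => h x + k x).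
  by move=> x; apply: cvgD; [exact: hc|exact: kc].
split=> // e e0; have e20 : 0 < e / 2 by rewrite divr_gt0.
apply: subclosed_compact (compactU (hv _ e20) (kv _ e20)) _.
  exact: closed_superlevel.
move=> x /= ex; case: (leP (e / 2) (h x)) => [|he]; [by left|right].
by rewrite /= leNgt; apply/negP => ke; move: ex; rewrite leNgt [e]splitr ltrD.
Qed.

Lemma vanishing_sum (I : Type) (s : seq I) (h : I -> X -> R) :
  (forall i, vanishing (h i)) -> vanishing (fun x => \sum_(i <- s) h i x).
Proof.
move=> hv; elim: s => [|i s IH].
  by under eq_fun do rewrite big_nil; exact: vanishing0.
by under eq_fun do rewrite big_cons; exact: vanishingD.
Qed.

Lemma vanishing_bounded h : vanishing h -> exists M : R, forall x, h x <= M.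
Proof.
move=> [hc hv].
have [K0|/set0P K0] := eqVneq [set x | 1 <= h x] set0.
  exists 1 => x; rewrite leNgt; apply/negP => x1.
  by have : [set x | 1 <= h x] x; [exact: ltW|rewrite K0].
have [c _ cM] := compact_EVT_max K0 (hv _ ltr01) (continuous_subspaceT hc).
exists (Num.max 1 (h c)) => x; rewrite le_max; case: (leP (h x) 1) => //= x1.
by apply: cM; rewrite inE /=; exact: ltW.
Qed.

Lemma C0P f : C0 f <-> continuous f /\ vanishing (fun x => cabs (f x)).
Proof.
split=> [[fc fv]|[fc [_ fv]]]; last by [].
by split=> //; split=> // x; apply: continuous_comp; [exact: fc|exact: cabs_continuous].
Qed.

Lemma C0_vanishing f : C0 f -> vanishing (fun x => cabs (f x)).
Proof. by case/C0P. Qed.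

Lemma C0_approx f : continuous f ->
  (forall e : R, 0 < e -> exists2 k, vanishing k & forall x, cabs (f x) <= e + k x) ->
  C0 f.
Proof.
move=> fc H; apply/C0P; split=> //; apply: vanishing_approx => // x.
by apply: continuous_comp; [exact: fc|exact: cabs_continuous].
Qed.

Lemma C0_le f k : continuous f -> vanishing k -> (forall x, cabs (f x) <= k x) -> C0 f.
Proof.
move=> fc kv H; apply: C0_approx => // e e0; exists k => // x.
by rewrite (le_trans (H x))// lerDr ltW.
Qed.

Lemma C0_const0 : C0 (fun _ : X => 0 : Cplx R).
Proof.
apply: (C0_le (k := fun=> 0)); first exact: cst_continuous.
  exact: vanishing0.
by move=> x; rewrite cabs0.
Qed.

Lemma C0_lin (a : Cplx R) f g : C0 f -> C0 g -> C0 (fun x => a * f x + g x).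
Proof.
move=> /C0P[fc fv] /C0P[gc gv].
apply: (C0_le (k := fun x => cabs a * cabs (f x) + cabs (g x))).
- move=> x; apply: cvgD; last exact: gc.
  by apply: cvgM; [exact: cvg_cst|exact: fc].
- by apply: vanishingD => //; apply: vanishingZ => //; exact: cabs_ge0.
- by move=> x; rewrite (le_trans (cabsD _ _))// cabsM.
Qed.

Lemma C0_conj f : C0 f -> C0 (fun x => (f x)^*).
Proof.
move=> /C0P[fc fv]; apply: (C0_le _ fv) => [x|x]; last by rewrite cabs_conj.
by apply: continuous_comp; [exact: fc|exact: conj_continuous].
Qed.

Lemma C0_bounded f : C0 f -> exists M : R, 0 <= M /\ forall x, cabs (f x) <= M.
Proof.
move=> /C0_vanishing/vanishing_bounded[M fM]; exists `|M|; split=> // x.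
by rewrite (le_trans (fM x))// ler_norm.
Qed.

Lemma C0_mulr (M : R) f g : C0 f -> continuous g -> (forall x, cabs (g x) <= M) ->
  C0 (fun x => f x * g x).
Proof.
move=> /C0P[fc fv] gc gM.
apply: (C0_le (k := fun x => `|M| * cabs (f x))).
- by move=> x; apply: cvgM; [exact: fc|exact: gc].
- exact: vanishingZ.
- move=> x; rewrite cabsM mulrC ler_wpM2r ?cabs_ge0//.
  by rewrite (le_trans (gM x))// ler_norm.
Qed.

Lemma C0M f g : C0 f -> C0 g -> C0 (fun x => f x * g x).
Proof. by move=> fC gC; have [M [_ gM]] := C0_bounded gC; apply: C0_mulr gM => //; case: gC. Qed.

Lemma C0_real h : vanishing h -> (forall x, 0 <= h x) ->
  C0 (fun x => (h x)%:C%C : Cplx R).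
Proof.
move=> hv h0; apply: (C0_le _ hv) => [x|x]; last by rewrite cabs_real ger0_norm.
by apply: continuous_comp; [exact: hv.1|exact: realC_continuous].
Qed.

End Vanishing.

(** * Finite covers and cut-off functions *)

Section LocallyCompact.
Variable X : topologicalType.

Lemma compact_finite_cover (K : set X) (W : X -> set X) : compact K ->
  (forall x, K x -> nbhs x (W x)) ->
  exists2 s : seq X, {in s, forall x, K x} & K `<=` [set y | exists2 x, x \in s & W x y].
Proof.
move=> /compact_near_coveringP Kc KW.
(* Along this filter, eventually means for all lists containing a given finite list. Near each point
   of [K], being covered by the sets attached to the list holds eventually in this sense, which is
   the near-covering form of compactness. *)
pose F : set_system (seq X) :=
  filter_from setT (fun s : seq X => [set t : seq X | {subset s <= t}]).
have FF : Filter F.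
  apply: filter_from_filter; first by exists [::].
  move=> s t _ _; exists (s ++ t) => // u /= stu.
  by split=> x xs; apply: stu; rewrite mem_cat xs ?orbT.
have [|s _ sK] := Kc _ F (fun s y => exists2 x, (x \in s) && `[< K x >] & W x y) FF.
  move=> x Kx; exists (W x, [set t : seq X | {subset [:: x] <= t}]) => /=.
    by split; [exact: KW|exists [:: x]].
  move=> [y t] /= [Wy xt]; exists x => //; apply/andP; split; last exact/asboolP.
  by apply: xt; rewrite inE.
exists [seq x <- s | `[< K x >]].
  by move=> x; rewrite mem_filter => /andP[/asboolP].
move=> y Ky; have [x /andP[xs Kx] Wy] := sK s (fun _ => id) y Ky.
by exists x => //; rewrite mem_filter Kx.
Qed.

Hypotheses (lcX : locally_compact [set: X]) (hX : hausdorff_space X).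

Lemma compact_nbhs_in (x : X) (O : set X) : nbhs x O ->
  exists K, [/\ compact K, K `<=` O & nbhs x K].
Proof.
move=> Ox; have := lcX (x := x) I; rewrite withinET => -[C Cx [Cc Ccl]].
have [W Wx WO] := compact_regular hX Cc Cx Ox.
exists (closure W `&` C); split.
- by apply: subclosed_compact Cc _ => //; apply: closedI => //; exact: closed_closure.
- by move=> y [/WO].
- by apply: filterI => //; apply: filterS Wx; exact: subset_closure.
Qed.

Lemma cutoff (R : realType) (x : X) (O : set X) : nbhs x O ->
  exists rho : X -> R, [/\ continuous rho, (forall y, 0 <= rho y <= 1),
    (\forall y \near x, rho y = 1) &
    exists K, [/\ compact K, K `<=` O & forall y, ~ K y -> rho y = 0]].
Proof.
move=> /compact_nbhs_in[K [Kc KO Kx]].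
have clB : closed (~` K^°) by apply: open_closedC; exact: open_interior.
have xB : ~ (~` K^°) x by move=> /(_ Kx).
have /(@uniform_separatorP _ R)[f [fc f01 fx fB]] :=
  locally_compact_completely_regular (R := R) lcX hX clB xB.
have {}f01 y : 0 <= f y <= 1.
  by have := f01 (f y) (imageT _ _); rewrite /= in_itv.
have {}fx : f x = 0 by apply: fx; exists x.
have {}fB y : ~ K y -> f y = 1.
  by move=> Ky; apply: fB; exists y => // /interior_subset.
(* The separating function [f] is only known to vanish at [x] itself; the rescaled function equals 1
   as soon as [f <= 1/2], hence on a whole neighbourhood of [x]. *)
exists (fun y => Num.min 1 (2 * (1 - f y))); split.
- move=> y; apply: (@continuous_min R X (cst 1) (fun y => 2 * (1 - f y))).
    exact: cvg_cst.
  by apply: cvgM; [exact: cvg_cst|apply: cvgB; [exact: cvg_cst|exact: fc]].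
- move=> y; have /andP[f0 f1] := f01 y.
  by rewrite le_min ler01 ge_min lexx mulr_ge0// subr_ge0.
- have /cvgrPdist_lt/(_ 2^-1) := fc x; rewrite invr_gt0 ltr0n => /(_ isT).
  apply: filterS => y; rewrite fx sub0r normrN => /ltr_normlW fy.
  by apply/min_idPl; lra.
- exists K; split=> // y /fB ->; rewrite subrr mulr0.
  by apply/min_idPr; exact: ler01.
Qed.

End LocallyCompact.

(** * Hermitian forms and Hilbert modules *)

Section HermitianForm.
Variables (R : realType) (E : lmodType (Cplx R)) (f : E -> E -> Cplx R).
Hypothesis fPr : forall a u v w, f u (a *: v + w) = a * f u v + f u w.
Hypothesis fC : forall u v, f v u = (f u v)^*.
Hypothesis f_ge0 : forall u, 0 <= f u u.

Lemma formPl a u v w : f (a *: u + v) w = a^* * f u w + f v w.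
Proof. by rewrite fC fPr rmorphD rmorphM /= -!fC. Qed.

Lemma form0r u : f u 0 = 0.
Proof. by have := fPr (-1) u 0 0; rewrite scaler0 addr0 mulN1r addNr. Qed.

Lemma form0l u : f 0 u = 0.
Proof. by rewrite fC form0r rmorph0. Qed.

Lemma formZr a u v : f u (a *: v) = a * f u v.
Proof. by rewrite -[a *: v]addr0 fPr form0r addr0. Qed.

Lemma formDr u v w : f u (v + w) = f u v + f u w.
Proof. by rewrite -[v in LHS]scale1r fPr mul1r. Qed.

Lemma formNr u v : f u (- v) = - f u v.
Proof. by rewrite -scaleN1r formZr mulN1r. Qed.

Lemma formZl a u v : f (a *: u) v = a^* * f u v.
Proof. by rewrite -[a *: u]addr0 formPl form0l addr0. Qed.

Lemma formDl u v w : f (u + v) w = f u w + f v w.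
Proof. by rewrite -[u in LHS]scale1r formPl rmorph1 mul1r. Qed.

Lemma formNl u v : f (- u) v = - f u v.
Proof. by rewrite -scaleN1r formZl rmorphN rmorph1 mulN1r. Qed.

Lemma form_sumr (I : Type) (s : seq I) (F : I -> E) u :
  f u (\sum_(i <- s) F i) = \sum_(i <- s) f u (F i).
Proof.
elim: s => [|i s IH]; first by rewrite !big_nil form0r.
by rewrite !big_cons formDr IH.
Qed.

Lemma form_suml (I : Type) (s : seq I) (F : I -> E) u :
  f (\sum_(i <- s) F i) u = \sum_(i <- s) f (F i) u.
Proof.
elim: s => [|i s IH]; first by rewrite !big_nil form0l.
by rewrite !big_cons formDl IH.
Qed.

Definition form_norm u : R := Num.sqrt (complex.Re (f u u)).

Lemma form_norm_ge0 u : 0 <= form_norm u.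
Proof. exact: sqrtr_ge0. Qed.

Lemma form_ReE u : f u u = (complex.Re (f u u))%:C%C.
Proof. by rewrite RRe_real// ger0_real. Qed.

Lemma form_Re_ge0 u : 0 <= complex.Re (f u u).
Proof. by rewrite -lecR -form_ReE; exact: f_ge0. Qed.

Lemma form_normE u : f u u = (form_norm u ^+ 2)%:C%C.
Proof. by rewrite /form_norm sqr_sqrtr ?form_Re_ge0// -form_ReE. Qed.

Lemma form_cabs u : cabs (f u u) = form_norm u ^+ 2.
Proof. by rewrite form_normE cabs_real ger0_norm ?sqr_ge0. Qed.

(** The form takes a nonnegative value at [- s f(u, v) u + v], a quadratic polynomial in the real
    number [s]. As the form is only semidefinite, [f u u = 0] is a case of its own. *)
Lemma form_CauchySchwarz u v : cabs (f u v) <= form_norm u * form_norm v.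
Proof.
rewrite -(@ler_pXn2r _ 2)// ?nnegrE ?cabs_ge0 ?mulr_ge0 ?form_norm_ge0//.
rewrite exprMn -!form_cabs.
set a := cabs (f u u); set b := cabs (f v v); set c := cabs (f u v) ^+ 2.
have a0 : 0 <= a := cabs_ge0 _.
have c0 : 0 <= c by rewrite sqr_ge0.
have pos (s : R) : 0 <= c * s ^+ 2 * a - 2 * s * c + b.
  have := f_ge0 ((- s%:C%C * f u v) *: u + v).
  have sJ : (s%:C%C : Cplx R)^* = s%:C%C by apply: conj_Creal; rewrite complex_real.
  rewrite fPr !formPl [f v u]fC !rmorphM !rmorphN /= sJ.
  set x := f u v.
  have -> : - s%:C%C * x * (- s%:C%C * x^* * f u u + x^*) + (- s%:C%C * x^* * x + f v v)
     = (x^* * x) * s%:C%C ^+ 2 * f u u - 2 * s%:C%C * (x^* * x) + f v v by ring.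
  rewrite mul_conjC (form_normE u) (form_normE v) -!form_cabs -/a -/b -/c.
  by rewrite -lecR !(rmorphD, rmorphM, rmorphN, rmorphXn, rmorph_nat).
have [a00|a_neq0] := eqVneq a 0.
  rewrite a00 mul0r; have [->//|c_neq0] := eqVneq c 0.
  (* For [a = 0] the polynomial is affine in [s]; this value of [s] makes it equal to -1. *)
  have := pos ((b + 1) / (2 * c)); rewrite a00 mulr0 add0r.
  have -> : 2 * ((b + 1) / (2 * c)) * c = b + 1 by field.
  by lra.
have := pos a^-1.
have -> : c * a^-1 ^+ 2 * a - 2 * a^-1 * c + b = (a * b - c) / a by field.
by rewrite pmulr_lge0 ?invr_gt0 ?lt0r ?a_neq0// subr_ge0.
Qed.

Lemma form_norm0 : form_norm 0 = 0.
Proof. by rewrite /form_norm form0r sqrtr0. Qed.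

Lemma form_normZ a u : form_norm (a *: u) = cabs a * form_norm u.
Proof.
apply/eqP; rewrite -(@eqrXn2 _ 2)// ?mulr_ge0 ?form_norm_ge0 ?cabs_ge0//.
by rewrite exprMn -!form_cabs formZr formZl !cabsM cabs_conj mulrA expr2.
Qed.

Lemma form_normD u v : form_norm (u + v) <= form_norm u + form_norm v.
Proof.
rewrite -(@ler_pXn2r _ 2)// ?nnegrE ?addr_ge0 ?form_norm_ge0//.
rewrite -form_cabs formDr !formDl sqrrD.
have h1 := cabsD (f u u + f v u) (f u v + f v v).
have h2 := cabsD (f u u) (f v u); have h3 := cabsD (f u v) (f v v).
have h4 := form_CauchySchwarz u v; have h5 := form_CauchySchwarz v u.
move: h2 h3; rewrite !form_cabs => h2 h3.
rewrite -mulr_natr; move: h4 h5; rewrite [form_norm v * _]mulrC.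
set p := form_norm u * form_norm v; lra.
Qed.

Lemma form_eq0l u v : form_norm u = 0 -> f u v = 0.
Proof.
move=> u0; apply/eqP; rewrite -cabs_eq0 eq_le cabs_ge0 andbT.
by have := form_CauchySchwarz u v; rewrite u0 mul0r.
Qed.

End HermitianForm.

(** * Pointwise seminorms, locality of adjointable operators, rank-one operators *)

Section HilbertModule.
Variables (R : realType) (X : topologicalType) (E : hilbert_module R X).
Implicit Types (u v w : E) (x : X) (S T : E -> E).

Let iP x a u v w := innerPr a u v w x.
Let iC x u v := innerC u v x.
Let i0 x u := inner_ge0 u x.

(** The seminorm whose separated quotient is the fibre of [E] at [x]. *)
Definition ptnorm u x : R := form_norm (fun u v : E => inner u v x) u.

Lemma ptnorm_ge0 u x : 0 <= ptnorm u x.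
Proof. exact: form_norm_ge0. Qed.

Lemma inner_ptnorm u x : inner u u x = (ptnorm u x ^+ 2)%:C%C.
Proof. exact: (form_normE (i0 x)). Qed.

Lemma cabs_inner u x : cabs (inner u u x) = ptnorm u x ^+ 2.
Proof. exact: (form_cabs (i0 x)). Qed.

Lemma inner_CauchySchwarz u v x : cabs (inner u v x) <= ptnorm u x * ptnorm v x.
Proof. exact: (form_CauchySchwarz (@iP x) (@iC x) (i0 x)). Qed.

Lemma ptnormD u v x : ptnorm (u + v) x <= ptnorm u x + ptnorm v x.
Proof. exact: (form_normD (@iP x) (@iC x) (i0 x)). Qed.

Lemma ptnorm0 x : ptnorm 0 x = 0.
Proof. exact: (form_norm0 (@iP x)). Qed.

Lemma inner_eq0l u v x : ptnorm u x = 0 -> inner u v x = 0.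
Proof. exact: (form_eq0l (@iP x) (@iC x) (i0 x)). Qed.

Lemma innerZl a u v x : inner (a *: u) v x = a^* * inner u v x.
Proof. exact: (formZl (@iP x) (@iC x)). Qed.

Lemma innerDl u v w x : inner (u + v) w x = inner u w x + inner v w x.
Proof. exact: (formDl (@iP x) (@iC x)). Qed.

Lemma innerNl u v x : inner (- u) v x = - inner u v x.
Proof. exact: (formNl (@iP x) (@iC x)). Qed.

Lemma innerDr u v w x : inner u (v + w) x = inner u v x + inner u w x.
Proof. exact: (formDr (@iP x)). Qed.

Lemma innerNr u v x : inner u (- v) x = - inner u v x.
Proof. exact: (formNr (@iP x)). Qed.

Lemma inner0r u x : inner u 0 x = 0.
Proof. exact: (form0r (@iP x)). Qed.

Lemma inner_ractl u v g x : C0 g -> inner (ract u g) v x = (g x)^* * inner u v x.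
Proof. by move=> gC; rewrite innerC inner_ract// rmorphM /= -innerC mulrC. Qed.

Lemma ptnorm_ract u g x : C0 g -> ptnorm (ract u g) x = cabs (g x) * ptnorm u x.
Proof.
move=> gC; apply/eqP; rewrite -(@eqrXn2 _ 2)// ?mulr_ge0 ?ptnorm_ge0 ?cabs_ge0//.
by rewrite exprMn -!cabs_inner inner_ract// inner_ractl// !cabsM cabs_conj; apply/eqP; ring.
Qed.

Lemma inner_inj u v : (forall w x, inner u w x = inner v w x) -> u = v.
Proof.
move=> uv; apply/eqP; rewrite -subr_eq0; apply/eqP/inner_eq0 => x.
by rewrite innerDl innerNl uv subrr.
Qed.

Lemma vanishing_ptnorm_sqr u : vanishing (fun x => ptnorm u x ^+ 2).
Proof.
have /C0_vanishing := inner_C0 u u.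
by under eq_fun do rewrite cabs_inner.
Qed.

Lemma supnorm_ub u x : ptnorm u x ^+ 2 <= supnorm (inner u u).
Proof.
apply: ub_le_sup; last by exists x => //; rewrite cabs_inner.
have [M uM] := vanishing_bounded (vanishing_ptnorm_sqr u).
by exists M => _ [y _ <-]; rewrite cabs_inner.
Qed.

Lemma hmnorm_ge0 u : 0 <= hmnorm u.
Proof. exact: sqrtr_ge0. Qed.

Lemma ptnorm_le_hmnorm u x : ptnorm u x <= hmnorm u.
Proof.
rewrite -[leLHS]ger0_norm ?ptnorm_ge0// -sqrtr_sqr ler_wsqrtr//.
exact: supnorm_ub.
Qed.

Lemma hmnorm_le u (c : R) : 0 <= c -> (forall x, ptnorm u x <= c) -> hmnorm u <= c.
Proof.
move=> c0 uc; rewrite -[leRHS]ger0_norm// -sqrtr_sqr ler_wsqrtr//.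
rewrite /supnorm; pose A := [set cabs (inner u u x) | x in setT]; rewrite -/A.
have [->|/set0P ne] := eqVneq A set0.
  by rewrite sup0 sqr_ge0.
apply: ge_sup => // _ [x _ <-]; rewrite cabs_inner.
by rewrite ler_pXn2r ?nnegrE ?ptnorm_ge0.
Qed.

Lemma hmnormD u v : hmnorm (u + v) <= hmnorm u + hmnorm v.
Proof.
apply: hmnorm_le => [|x]; first by rewrite addr_ge0 ?hmnorm_ge0.
by rewrite (le_trans (ptnormD _ _ _))// lerD ?ptnorm_le_hmnorm.
Qed.

Lemma hmnormN u : hmnorm (- u) = hmnorm u.
Proof.
rewrite /hmnorm; congr (Num.sqrt (supnorm _)); apply/funext => x.
by rewrite innerNl innerNr opprK.
Qed.

Lemma hmnorm0 : hmnorm (0 : E) = 0.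
Proof.
apply/eqP; rewrite eq_le hmnorm_ge0 andbT.
by apply: hmnorm_le => // x; rewrite ptnorm0.
Qed.

Lemma hmnorm_sum (I : Type) (s : seq I) (F : I -> E) :
  hmnorm (\sum_(i <- s) F i) <= \sum_(i <- s) hmnorm (F i).
Proof.
elim: s => [|i s IH]; first by rewrite !big_nil hmnorm0.
by rewrite !big_cons (le_trans (hmnormD _ _))// lerD2l.
Qed.

Lemma opnorm_leW S a b : a <= b -> opnorm_le S a -> opnorm_le S b.
Proof. by move=> ab Sa u; rewrite (le_trans (Sa u))// ler_wpM2r ?hmnorm_ge0. Qed.

Lemma is_adjoint_sym S T : is_adjoint S T -> is_adjoint T S.
Proof. by move=> ST u v x; rewrite innerC -ST -innerC. Qed.

Lemma adjointableZ T a u : adjointable T -> T (a *: u) = a *: T u.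
Proof.
move=> [T' TT']; apply: inner_inj => w x.
by rewrite TT' !innerZl TT'.
Qed.

Lemma adjointable0 T : adjointable T -> T 0 = 0.
Proof. by move=> /(@adjointableZ T 0 0); rewrite !scale0r. Qed.

Lemma adjointableB T u v : adjointable T -> T (u - v) = T u - T v.
Proof.
move=> [T' TT']; apply: inner_inj => w x.
by rewrite TT' !innerDl !innerNl !TT'.
Qed.

Lemma is_adjoint_unique S T T' : is_adjoint S T -> is_adjoint S T' -> T = T'.
Proof.
move=> ST ST'; apply/funext => v; apply: inner_inj => w x.
by rewrite innerC -ST ST' -innerC.
Qed.

(** [<Su, Su> = <u, T S u>] vanishes at [x] by Cauchy-Schwarz. This is what lets [S] act on the
    fibre at [x]. *)
Lemma adjoint_local S T u x : is_adjoint S T -> ptnorm u x = 0 -> ptnorm (S u) x = 0.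
Proof.
move=> ST u0; apply/eqP; rewrite -sqrf_eq0 -cabs_inner ST.
by rewrite inner_eq0l// cabs0.
Qed.

Definition rank1 u v : E -> E := fun w => ract u (inner v w).

Lemma is_adjoint_rank1 u v : is_adjoint (rank1 u v) (rank1 v u).
Proof.
move=> w w' x; rewrite inner_ractl ?inner_ract; try exact: inner_C0.
by rewrite -innerC mulrC.
Qed.

Lemma ptnorm_rank1 u v w x :
  ptnorm (rank1 u v w) x <= ptnorm u x * ptnorm v x * ptnorm w x.
Proof.
rewrite ptnorm_ract; last exact: inner_C0.
by rewrite mulrC -mulrA ler_wpM2l ?ptnorm_ge0 ?inner_CauchySchwarz.
Qed.

Lemma opnorm_rank1 u v : opnorm_le (rank1 u v) (hmnorm u * hmnorm v).
Proof.
move=> w; apply: hmnorm_le => [|x]; first by rewrite !mulr_ge0 ?hmnorm_ge0.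
apply: le_trans (ptnorm_rank1 u v w x) _.
by rewrite !ler_pM ?mulr_ge0 ?ptnorm_ge0 ?ptnorm_le_hmnorm.
Qed.

Lemma finite_rankE (s : seq (E * E)) w :
  finite_rank_op s w = \sum_(p <- s) rank1 p.1 p.2 w.
Proof. by []. Qed.

Lemma compact_rank1 u v : compact_op (rank1 u v).
Proof.
split; first by exists (rank1 v u); exact: is_adjoint_rank1.
move=> e e0; exists [:: (u, v)] => w.
rewrite /= finite_rankE big_cons big_nil addr0 subrr hmnorm0.
by rewrite mulr_ge0 ?hmnorm_ge0// ltW.
Qed.

End HilbertModule.

(** * Hermitian bundles *)

Lemma continuous_near_eq (T S : topologicalType) (f g : T -> S) (x : T) :
  (\forall y \near x, f y = g y) -> {for x, continuous f} -> {for x, continuous g}.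
Proof.
move=> fg fc A; rewrite -(nbhs_singleton fg) => /fc.
by apply: filterS2 fg => y /= ->.
Qed.

Lemma continuous_mxP (T S : topologicalType) (m n : nat) (f : T -> 'M[S]_(m, n)) (x : T) :
  {for x, continuous f} <-> forall i j, {for x, continuous (fun y => f y i j)}.
Proof.
split=> [fc i j A Afx|fc A [P Pfx PA]].
  (* Neighbourhoods of a matrix are products over the entries: the entry [(i, j)] is constrained and
     the others are left free. *)
  apply: (fc [set M | A (M i j)]); exists (fun i' j' => [set a | (i', j') = (i, j) -> A a]).
    move=> i' j'; have [[-> ->]|ne] := pselect ((i', j') = (i, j)).
      by apply: filterS Afx => a Aa _.
    by apply: filterS filterT => a _ /ne.
  by move=> M /(_ i j); apply.
have := filter_forall (nbhs_filter x)
  (fun i => filter_forall (nbhs_filter x) (fun j => fc i j _ (Pfx i j))).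
by apply: filterS => y Py; apply: PA => i j; exact: Py.
Qed.

Lemma continuous_sum (K : numFieldType) (T : topologicalType) (I : Type) (s : seq I)
    (f : I -> T -> K) (x : T) : (forall i, {for x, continuous (f i)}) ->
  {for x, continuous (fun y => \sum_(i <- s) f i y)}.
Proof.
move=> fc; elim: s => [|i s IH].
  apply: (@continuous_near_eq _ _ (fun=> 0)); last exact: cst_continuous.
  by apply: nearW => y; rewrite big_nil.
apply: (@continuous_near_eq _ _ (fun y => f i y + \sum_(i <- s) f i y)).
  by apply: nearW => y; rewrite big_cons.
by apply: cvgD; [exact: fc|exact: IH].
Qed.

Lemma linear_sumZ (K : ringType) (U W : lmodType K) (f : U -> W) (I : Type) (s : seq I)
    (a : I -> K) (v : I -> U) : linear f ->
  f (\sum_(i <- s) a i *: v i) = \sum_(i <- s) a i *: f (v i).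
Proof.
move=> fl; elim: s => [|i s IH].
  by rewrite !big_nil; have := fl (-1) 0 0; rewrite scaler0 addr0 scaleN1r addNr.
by rewrite !big_cons fl IH.
Qed.

Lemma cV_sum_basis (R : realType) (n : nat) (v : 'cV[Cplx R]_n) :
  v = \sum_k v k 0 *: basis_vec R k.
Proof.
apply/colP => i; rewrite summxE (bigD1 i)//= big1 ?addr0 => [|k ki].
  by rewrite !mxE !eqxx mulr1.
by rewrite !mxE eq_sym (negbTE ki) mulr0.
Qed.

Lemma open_setX (T S : topologicalType) (A : set T) (B : set S) :
  open A -> open B -> open (A `*` B).
Proof.
rewrite !openE => Ao Bo [x y] [/= Ax By].
by exists (A, B) => //; split; [exact: Ao|exact: Bo].
Qed.

Section BundleTheory.
Variables (R : realType) (B : topologicalType) (V : herm_bundle R B).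
Implicit Types (xi eta : bundle_section V) (b : B).

Lemma hip_ge0 b (u : fib V b) : 0 <= hip u u.
Proof.
have [->|u0] := eqVneq u 0; last exact/ltW/hip_gt0.
by rewrite (form0r (@hipP _ _ V b)).
Qed.

Section Fibre.
Variable b : B.
Implicit Types u v w : fib V b.
Let hP := @hipP _ _ V b.
Let hC := @hipC _ _ V b.

Lemma fibnorm_ge0 u : 0 <= fibnorm u. Proof. exact: sqrtr_ge0. Qed.

Lemma hip_fibnorm u : hip u u = (fibnorm u ^+ 2)%:C%C.
Proof. exact: (form_normE (@hip_ge0 b)). Qed.

Lemma hip_CauchySchwarz u v : cabs (hip u v) <= fibnorm u * fibnorm v.
Proof. exact: (form_CauchySchwarz hP hC (@hip_ge0 b)). Qed.

Lemma fibnormZ a u : fibnorm (a *: u) = cabs a * fibnorm u.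
Proof. exact: (form_normZ hP hC (@hip_ge0 b)). Qed.

Lemma fibnormD u v : fibnorm (u + v) <= fibnorm u + fibnorm v.
Proof. exact: (form_normD hP hC (@hip_ge0 b)). Qed.

Lemma fibnorm0 : fibnorm (0 : fib V b) = 0.
Proof. exact: (form_norm0 hP). Qed.

Lemma hipZl a u v : hip (a *: u) v = a^* * hip u v.
Proof. exact: (formZl hP hC). Qed.

Lemma hipZr a u v : hip u (a *: v) = a * hip u v.
Proof. exact: (formZr hP). Qed.

Lemma hip0l u : hip 0 u = 0.
Proof. exact: (form0l hP hC). Qed.

Lemma hip0r u : hip u 0 = 0.
Proof. exact: (form0r hP). Qed.

Lemma hip_suml (I : Type) (s : seq I) (F : I -> fib V b) u :
  hip (\sum_(i <- s) F i) u = \sum_(i <- s) hip (F i) u.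
Proof. exact: (form_suml hP hC). Qed.

Lemma hip_sumr (I : Type) (s : seq I) (F : I -> fib V b) u :
  hip u (\sum_(i <- s) F i) = \sum_(i <- s) hip u (F i).
Proof. exact: (form_sumr hP). Qed.

Lemma hip_eq0 u : (hip u u == 0) = (u == 0).
Proof.
have [->|u0] := eqVneq u 0; first by rewrite hip0r eqxx.
by apply/negbTE; rewrite gt_eqF// hip_gt0.
Qed.

Lemma fibnorm_eq0 u : (fibnorm u == 0) = (u == 0).
Proof. by rewrite -hip_eq0 hip_fibnorm -sqrf_eq0; apply/eqP/eqP => [->//|/complexI]. Qed.

End Fibre.

Definition scont_at xi b : Prop :=
  {for b, continuous (fun y => pt V (existT _ y (xi y)))}.

Lemma continuous_sectionP (O : set B) xi : open O ->
  continuous_section O xi <-> forall b, O b -> scont_at xi b.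
Proof.
move=> Oo; rewrite /continuous_section continuous_open_subspace//.
by split=> H b Ob; [apply: H; rewrite inE|apply: H; rewrite inE in Ob].
Qed.

Lemma scont_near xi eta b : (\forall y \near b, xi y = eta y) ->
  scont_at xi b -> scont_at eta b.
Proof. by move=> xe; apply: continuous_near_eq; apply: filterS xe => y ->. Qed.

Section Trivialization.
Variables (n : nat) (W : set B) (h : forall b, 'cV[Cplx R]_n -> fib V b).
Hypothesis ht : trivialization (pt V) W h.

(** The inverses are chosen for all base points at once, as a total family, so that the coordinates
    of a section form a function into one fixed type. Off [W] the values are meaningless. *)
Lemma triv_coord : exists c : forall b, fib V b -> 'cV[Cplx R]_n,
  forall b, W b -> cancel (h b) (c b) /\ cancel (c b) (h b).
Proof.
have [_ hW _ _] := ht.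
exists (fun b v => xget 0 [set w | h b w = v]) => b Wb.
have [_ [g gK Kg]] := hW b Wb.
have H v : h b (xget 0 [set w | h b w = v]) = v :> fib V b.
  by rewrite (@xgetPex _ 0 [set w | h b w = v])//; exists (g v); exact: Kg.
split=> v; last exact: H.
by apply: (can_inj gK); exact: H.
Qed.

Lemma triv_continuous p : W p.1 ->
  {for p, continuous (fun q : B * 'cV[Cplx R]_n => pt V (existT _ q.1 (h q.1 q.2)))}.
Proof.
have [Wo _ + _] := ht; rewrite continuous_open_subspace => [H Wp|]; first by apply: H; rewrite inE.
exact: open_setX Wo openT.
Qed.

Variable c : forall b, fib V b -> 'cV[Cplx R]_n.
Hypothesis cP : forall b, W b -> cancel (h b) (@c b) /\
  cancel (@c b) (h b).

(** Openness of the trivialization makes the coordinates of a continuous section continuous; its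
    continuity gives the converse. *)
Lemma scont_coordP xi b : W b ->
  scont_at xi b <-> {for b, continuous (fun y => c (xi y))}.
Proof.
move=> Wb; have [Wo hW _ Ho] := ht; split=> [xc A|cc].
  rewrite nbhsE => -[N [No Nc] NA].
  have := Ho (W `*` N) (open_setX Wo No) (fun q Wq => conj Wq.1 I).
  set G := _ @` _ => Go.
  have Gb : nbhs (pt V (existT _ b (xi b))) G.
    apply: open_nbhs_nbhs; split=> //; exists (b, c (xi b)) => //=.
    by rewrite (cP Wb).2.
  have xG : nbhs b (fun y => G (pt V (existT _ y (xi y)))) := xc _ Gb.
  suff : nbhs b (fun y => A (c (xi y))) by [].
  apply: filterS xG => y [[b' c'] /= [Wb' Nc'] e0].
  have e := bij_inj (@pt_bij _ _ V) e0.
  (* Applying the coordinate map to the equality of dependent pairs avoids a transport along the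
     equality of base points. *)
  have := congr1 (fun q => c (tagged q)) e; rewrite /= (cP Wb').1 => <-.
  exact: NA.
apply: (@continuous_near_eq _ _ (fun y => pt V (existT _ y (h y (c (xi y)))))).
  by apply: filterS (open_nbhs_nbhs (conj Wo Wb)) => y Wy; rewrite (cP Wy).2.
apply: (@continuous_comp _ _ _ (fun y => (y, c (xi y)))
  (fun q : B * 'cV[Cplx R]_n => pt V (existT _ q.1 (h q.1 q.2)))).
  have cc' : c (xi y) @[y --> b] --> c (xi b) by exact: cc.
  exact: (@cvg_pair _ _ _ (nbhs b) (nbhs b) (nbhs (c (xi b))) (nbhs_filter _)
    (nbhs_filter _) (nbhs_filter _) _ _ (@cvg_id _ (nbhs b)) cc').
exact: triv_continuous.
Qed.

Lemma scont_frame (v : 'cV[Cplx R]_n) b : W b -> scont_at (fun y => h y v) b.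
Proof.
move=> Wb; apply/scont_coordP => //.
have [Wo _ _ _] := ht.
apply: (@continuous_near_eq _ _ (fun=> v)); last exact: cst_continuous.
by apply: filterS (open_nbhs_nbhs (conj Wo Wb)) => y Wy; rewrite (cP Wy).1.
Qed.

Lemma triv_basis b (v : 'cV[Cplx R]_n) : W b ->
  h b v = \sum_k v k 0 *: h b (basis_vec R k) :> fib V b.
Proof.
by move=> Wb; have [_ /(_ _ Wb)[hl _] _ _] := ht; rewrite {1}[v]cV_sum_basis linear_sumZ.
Qed.

Lemma coord_linear b : W b -> linear (@c b).
Proof.
move=> Wb a u v; have [_ /(_ _ Wb)[hl _] _ _] := ht; have [hK cK] := cP Wb.
by apply: (can_inj hK); rewrite cK hl !cK.
Qed.

End Trivialization.

Lemma local_frame b : exists n W (h : forall b, 'cV[Cplx R]_n -> fib V b)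
    (c : forall b, fib V b -> 'cV[Cplx R]_n),
  [/\ W b, trivialization (pt V) W h,
     (forall b, W b -> cancel (h b) (c b) /\ cancel (c b) (h b)) &
     forall v w y, W y -> {for y, continuous (fun y => hip (h y v) (h y w))}].
Proof.
have [n [W [h [Wb ht gram]]]] := local_triv V b.
have [c cP] := triv_coord ht; exists n, W, h, c; split=> // v w y Wy.
have := gram v w; have [Wo _ _ _] := ht.
by rewrite continuous_open_subspace// => H; apply: H; rewrite inE.
Qed.

(** In a local frame the inner product is a polynomial in the coordinates, their conjugates and the
    Gram matrix, whose continuity is part of local triviality. *)
Lemma hip_continuous xi eta b : scont_at xi b -> scont_at eta b ->
  {for b, continuous (fun y => hip (xi y) (eta y))}.
Proof.
have [n [W [h [c [Wb ht cP gram]]]]] := local_frame b.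
move=> /(scont_coordP ht cP xi Wb)/continuous_mxP xc /(scont_coordP ht cP eta Wb)/continuous_mxP ec.
apply: (@continuous_near_eq _ _ (fun y => \sum_k \sum_l
   (c y (xi y) k 0)^* * (c y (eta y) l 0 * hip (h y (basis_vec R k)) (h y (basis_vec R l))))).
  have [Wo _ _ _] := ht.
  apply: filterS (open_nbhs_nbhs (conj Wo Wb)) => y Wy.
  rewrite -[xi y in RHS](cP y Wy).2 -[eta y in RHS](cP y Wy).2.
  rewrite !(triv_basis ht (b := y))// hip_suml; apply: eq_bigr => k _.
  by rewrite hip_sumr; apply: eq_bigr => l _; rewrite hipZl hipZr.
apply: continuous_sum => k; apply: continuous_sum => l.
apply: cvgM; first by apply: continuous_comp; [exact: xc|exact: conj_continuous].
by apply: cvgM; [exact: ec|exact: gram].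
Qed.

Lemma scont_lin (a : B -> Cplx R) xi eta b : {for b, continuous a} ->
  scont_at xi b -> scont_at eta b -> scont_at (fun y => a y *: xi y + eta y) b.
Proof.
have [n [W [h [c [Wb ht cP _]]]]] := local_frame b.
move=> ac /(scont_coordP ht cP xi Wb)/continuous_mxP xc.
move=> /(scont_coordP ht cP eta Wb)/continuous_mxP ec.
apply/(scont_coordP ht cP _ Wb)/continuous_mxP => i j.
apply: (@continuous_near_eq _ _ (fun y => a y * c y (xi y) i j + c y (eta y) i j)).
  have [Wo _ _ _] := ht.
  apply: filterS (open_nbhs_nbhs (conj Wo Wb)) => y Wy.
  by rewrite (coord_linear ht cP Wy) !mxE.
by apply: cvgD; [apply: cvgM; [exact: ac|exact: xc]|exact: ec].
Qed.

Lemma scont0 b : scont_at (fun y => 0) b.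
Proof.
have [n [W [h [c [Wb ht cP _]]]]] := local_frame b.
refine (scont_near _ (@scont_frame _ _ _ ht _ cP 0 b Wb)).
have [Wo _ _ _] := ht; apply: filterS (open_nbhs_nbhs (conj Wo Wb)) => y Wy.
by rewrite (triv_basis ht)// big1// => k _; rewrite mxE scale0r.
Qed.

Lemma scontZ (a : B -> Cplx R) xi b : {for b, continuous a} ->
  scont_at xi b -> scont_at (fun y => a y *: xi y) b.
Proof.
move=> ac xc; refine (scont_near _ (scont_lin ac xc (@scont0 b))).
by apply: nearW => y; rewrite addr0.
Qed.

Lemma fibnorm_continuous xi b : scont_at xi b ->
  {for b, continuous (fun y => fibnorm (xi y))}.
Proof.
move=> xc; have hc := hip_continuous xc xc.
apply: (@continuous_comp _ _ _ (fun y => complex.Re (hip (xi y) (xi y))) Num.sqrt).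
  by apply: continuous_comp; [exact: hc|exact: Re_continuous].
exact: sqrt_continuous.
Qed.

Lemma Gamma0P xi : Gamma0 xi <->
  (forall b, scont_at xi b) /\ vanishing (fun b => fibnorm (xi b)).
Proof.
rewrite /Gamma0 continuous_sectionP; last exact: openT.
split=> [[xc xv]|[xc [_ xv]]]; last by split.
split=> [b|]; first exact: xc.
by split=> // b; apply: fibnorm_continuous; exact: xc.
Qed.

Lemma Gamma0_mul (f : B -> Cplx R) (M : R) xi : continuous f ->
  (forall b, cabs (f b) <= M) -> Gamma0 xi -> Gamma0 (fun b => f b *: xi b).
Proof.
move=> fc fM /Gamma0P[xc xv]; apply/Gamma0P.
have sc b : scont_at (fun b => f b *: xi b) b by apply: scontZ; [exact: fc|exact: xc].
split=> //; apply: (vanishing_le (k := fun b => `|M| * fibnorm (xi b))).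
- by move=> b; apply: fibnorm_continuous.
- exact: vanishingZ.
- move=> b; rewrite fibnormZ ler_wpM2r ?fibnorm_ge0//.
  by rewrite (le_trans (fM b))// ler_norm.
Qed.

Lemma Gamma0_C0 xi eta : Gamma0 xi -> Gamma0 eta -> C0 (fun b => hip (xi b) (eta b)).
Proof.
move=> /Gamma0P[xc xv] /Gamma0P[ec ev].
have [M eM] := vanishing_bounded ev.
apply: (C0_le (k := fun b => `|M| * fibnorm (xi b))).
- by move=> b; exact: hip_continuous.
- exact: vanishingZ.
- move=> b; rewrite (le_trans (hip_CauchySchwarz _ _))// mulrC.
  by rewrite ler_wpM2r ?fibnorm_ge0// (le_trans (eM b))// ler_norm.
Qed.

Hypotheses (lcB : locally_compact [set: B]) (hB : hausdorff_space B).

(** [xi] may be discontinuous outside [O]: off a compact subset of [O] the product is locally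
    zero. *)
Lemma cutoff_section b (O : set B) xi : open O -> O b ->
  (forall y, O y -> scont_at xi y) ->
  exists rho : B -> R, [/\ (forall y, 0 <= rho y <= 1),
    (forall y, ~ O y -> rho y = 0), (\forall y \near b, rho y = 1) &
    Gamma0 (fun y => (rho y)%:C%C *: xi y)].
Proof.
move=> Oo Ob xc.
have [rho [rc r01 r1 [K [Kc KO rK]]]] := cutoff lcB hB R (open_nbhs_nbhs (conj Oo Ob)).
exists rho; split=> // [y Oy|]; first by apply: rK => /KO.
have sc y : scont_at (fun y => (rho y)%:C%C *: xi y) y.
  have [Ky|nKy] := pselect (K y).
    apply: scontZ; last exact/xc/KO.
    by apply: continuous_comp; [exact: rc|exact: realC_continuous].
  refine (scont_near _ (@scont0 y)).
  have : nbhs y (~` K).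
    by apply: open_nbhs_nbhs; split=> //; apply: closed_openC; exact: compact_closed.
  by apply: filterS => z /rK ->; rewrite scale0r.
apply/Gamma0P; split=> //; split=> [y|e e0]; first exact: fibnorm_continuous.
apply: subclosed_compact Kc _.
  by apply: closed_superlevel => y; exact: fibnorm_continuous.
move=> y /= ey; apply: contrapT => /rK ry.
by move: ey; rewrite ry scale0r fibnorm0 leNgt e0.
Qed.

End BundleTheory.

(** * Sections of a line bundle over Z *)

(** Take a nonzero vector at [z0], keep its coordinates constant in a local frame, and normalize
    where the resulting section does not vanish. *)
Lemma local_unit_section (R : realType) (Z : topologicalType) (L : herm_bundle R Z)
    (z0 : Z) : line_bundle L ->
  exists (O : set Z) (t : bundle_section L),
    [/\ open O, O z0 & forall z, O z -> scont_at t z /\ fibnorm (t z) = 1].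
Proof.
move=> /(_ z0)[l l0 _].
have [n [W [h [c [Wz ht cP _]]]]] := local_frame L z0.
have [Wo _ _ _] := ht.
pose t z := h z (c z0 l); pose q z := fibnorm (t z).
have tc z : W z -> scont_at t z by move=> Wz'; exact: (scont_frame ht cP).
have qc : {in (W : set Z), continuous q}.
  by move=> z; rewrite inE => Wz'; apply: fibnorm_continuous; exact: tc.
pose O := W `&` q @^-1` [set r | r != 0].
have Oo : open O by apply: (continuous_inP _ Wo).1 => //; exact: open_neq.
exists O, (fun z => ((q z)^-1)%:C%C *: t z); split=> //.
  by split=> //=; rewrite /q /t (cP z0 Wz).2 fibnorm_eq0.
move=> z [Wz' /= qz]; split.
  apply: scontZ; last exact: tc.
  apply: continuous_comp; last exact: realC_continuous.
  by apply: cvgV => //; apply: qc; rewrite inE.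
rewrite fibnormZ cabs_real ger0_norm ?invr_ge0 ?fibnorm_ge0//.
by rewrite mulVf.
Qed.

(** * Elements supported on a slice, and multiplication operators *)

Section SectionModule.
Variables (R : realType) (X Z : topologicalType) (E : hilbert_module R X)
  (s : Z -> X) (L : herm_bundle R Z) (Psi : E -> bundle_section L).
Hypothesis iso : Gamma0_iso s Psi.
Implicit Types (u v w : E) (x : X) (y z : Z).

Lemma iso_lin a u v z : Psi (a *: u + v) z = a *: Psi u z + Psi v z.
Proof. exact: giso_linear iso _ _ _ _. Qed.

Lemma iso0 z : Psi 0 z = 0.
Proof. by have := iso_lin (-1) 0 0 z; rewrite scaler0 addr0 scaleN1r addNr. Qed.

Lemma isoZ a u z : Psi (a *: u) z = a *: Psi u z.
Proof. by rewrite -[a *: u]addr0 iso_lin iso0 addr0. Qed.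

Lemma isoD u v z : Psi (u + v) z = Psi u z + Psi v z.
Proof. by rewrite -[u in LHS]scale1r iso_lin scale1r. Qed.

Lemma isoB u v z : Psi (u - v) z = Psi u z - Psi v z.
Proof. by rewrite isoD -scaleN1r isoZ scaleN1r. Qed.

Lemma iso_sum (I : Type) (r : seq I) (F : I -> E) z :
  Psi (\sum_(i <- r) F i) z = \sum_(i <- r) Psi (F i) z.
Proof.
elim: r => [|i r IH]; first by rewrite !big_nil iso0.
by rewrite !big_cons isoD IH.
Qed.

Lemma iso_ext u v : (forall z, Psi u z = Psi v z) -> u = v.
Proof. by move=> uv; apply: (giso_inj iso); apply: functional_extensionality_dep. Qed.

Lemma iso_ract u f z : C0 f -> Psi (ract u f) z = f (s z) *: Psi u z.
Proof. exact: giso_ract iso _ _ _. Qed.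

Lemma iso_scont u z : scont_at (Psi u) z.
Proof. by have /Gamma0P[+ _] := giso_Gamma0 iso u; apply. Qed.

Lemma iso_fibnorm_vanishing u : vanishing (fun z => fibnorm (Psi u z)).
Proof. by have /Gamma0P[] := giso_Gamma0 iso u. Qed.

(** In the decomposition of E_x, [x = s z], such a [u] represents a vector of the single line
    L_z. *)
Definition concentrated u z : Prop := forall z', s z' = s z -> z' <> z -> Psi u z' = 0.

(** At most one term of each fibre sum involving [u] survives, so the norm of [u] is controlled by
    its fibre norms. The rank-one operators built from such elements will normalize the
    multiplication algebra. *)
Definition slice_supported u : Prop := set_inj [set z | Psi u z != 0] s.

Lemma slice_concentrated u z : slice_supported u -> Psi u z != 0 -> concentrated u z.
Proof.
move=> us uz z' sz' zz'; apply/eqP; apply: contrapT => /negP uz'.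
by apply: zz'; apply: us => //; rewrite inE.
Qed.

Lemma inner_concentrated u v z : concentrated u z ->
  inner u v (s z) = hip (Psi u z) (Psi v z).
Proof.
move=> uz; rewrite (giso_inner iso) -(fsbig_widen [set z]) ?fsbig_set1//.
  by move=> _ ->.
by move=> z' [/= sz' zz']; rewrite uz ?hip0l// => zE; apply: zz'.
Qed.

Lemma inner_vanish u v x : (forall z, s z = x -> Psi u z = 0) -> inner u v x = 0.
Proof. by move=> u0; rewrite (giso_inner iso) fsbig1// => z /= /u0 ->; rewrite hip0l. Qed.

Lemma iso_inner_eq u u' v v' x :
  (forall z, s z = x -> hip (Psi u z) (Psi v z) = hip (Psi u' z) (Psi v' z)) ->
  inner u v x = inner u' v' x.
Proof.
move=> H; rewrite !(giso_inner iso); apply: eq_fsbigr => z.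
by rewrite inE; exact: H.
Qed.

Lemma inner_slice u v z : slice_supported u -> Psi u z != 0 ->
  inner u v (s z) = hip (Psi u z) (Psi v z).
Proof. by move=> us uz; rewrite inner_concentrated//; exact: slice_concentrated. Qed.

Lemma slice_hmnorm_le u (M : R) : slice_supported u -> 0 <= M ->
  (forall z, fibnorm (Psi u z) <= M) -> hmnorm u <= M.
Proof.
move=> us M0 uM; apply: hmnorm_le => // x.
rewrite -(@ler_pXn2r _ 2)// ?nnegrE ?ptnorm_ge0// -cabs_inner.
have [[z [<- uz]]|H] := pselect (exists z, s z = x /\ Psi u z != 0).
  rewrite (inner_slice _ us uz) hip_fibnorm cabs_real ger0_norm ?sqr_ge0//.
  by rewrite ler_pXn2r ?nnegrE ?fibnorm_ge0.
rewrite inner_vanish ?cabs0 ?sqr_ge0// => z sz.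
by apply/eqP; apply: contrapT => /negP uz; apply: H; exists z.
Qed.

Lemma slice_ract u f : C0 f -> slice_supported u -> slice_supported (ract u f).
Proof.
move=> fC us z z'; rewrite !inE /= !iso_ract// !scaler_eq0 !negb_or.
by move=> /andP[_ uz] /andP[_ uz']; apply: us; rewrite inE.
Qed.

Definition mult (f : Z -> Cplx R) (T : E -> E) : Prop :=
  forall u z, Psi (T u) z = f z *: Psi u z.

Lemma mult_unique f S T : mult f S -> mult f T -> S = T.
Proof. by move=> fS fT; apply/funext => u; apply: iso_ext => z; rewrite fS fT. Qed.

Lemma mult_exists f (M : R) : continuous f -> (forall z, cabs (f z) <= M) ->
  exists T, mult f T.
Proof.
move=> fc fM.
have /choice[T fT] : forall u, exists v, forall z, Psi v z = f z *: Psi u z.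
  move=> u; have [v vE] := giso_surj iso (Gamma0_mul fc fM (giso_Gamma0 iso u)).
  by exists v => z; rewrite vE.
by exists T.
Qed.

Lemma mult_C0_exists f : C0 f -> exists T, mult f T.
Proof. by move=> fC; have [M [_ fM]] := C0_bounded fC; apply: mult_exists fM; case: fC. Qed.

Lemma mult_lin a f g S T : mult f S -> mult g T ->
  mult (fun z => a * f z + g z) (a \*: S \+ T).
Proof. by move=> fS gT u z /=; rewrite iso_lin fS gT scalerDl scalerA. Qed.

Lemma multB f g S T : mult f S -> mult g T -> mult (fun z => f z - g z) (S \- T).
Proof. by move=> fS gT u z /=; rewrite isoB fS gT scalerBl. Qed.

Lemma mult_comp f g S T : mult f S -> mult g T -> mult (fun z => f z * g z) (S \o T).
Proof. by move=> fS gT u z /=; rewrite fS gT scalerA. Qed.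

Lemma mult_sum (I : Type) (r : seq I) (f : I -> Z -> Cplx R) (T : I -> E -> E) :
  (forall i, mult (f i) (T i)) ->
  mult (fun z => \sum_(i <- r) f i z) (fun u => \sum_(i <- r) T i u).
Proof.
by move=> fT u z; rewrite iso_sum scaler_suml; apply: eq_bigr => i _; exact: fT.
Qed.

Lemma mult_adjoint f S T : mult f S -> mult (fun z => (f z)^*) T -> is_adjoint S T.
Proof. by move=> fS fT u v x; apply: iso_inner_eq => z _; rewrite fS fT hipZl hipZr. Qed.

Hypotheses (sl : local_homeomorphism s) (sp : proper_onto_image s).

(** A nonempty fibre is compact because [s] is proper onto its image, and discrete because [s] is
    locally injective. Finiteness turns the finitely supported sums of [inner] into honest sums over
    the fibre. *)
Lemma fibre_finite x : finite_set (s @^-1` [set x]).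
Proof.
have [[z0 z0x]|nx] := pselect (exists z, s z = x); last first.
  rewrite (_ : _ @^-1` _ = set0); first exact: finite_set0.
  by rewrite -subset0 => z /= zx; apply: nx; exists z.
have Kc : compact (s @^-1` [set x]).
  by apply: sp; [exact: compact_set1|move=> _ ->; exists z0].
have [_ /(_ _)/cid sU] := sl; pose U z := projT1 (sU z).
have UP z : [/\ open (U z), U z z & set_inj (U z) s].
  by rewrite /U; case: (sU z) => /= W [].
have [|r rK rc] := compact_finite_cover (W := U) Kc.
  by move=> z _; apply: open_nbhs_nbhs; have [] := UP z.
apply: (@sub_finite_set _ _ [set` r]); last exact: finite_seq.
move=> y /[dup] yx /rc[z /= zr Uy].
have [_ Uz inj] := UP z.
suff -> : y = z by [].
by apply: inj; rewrite ?inE// yx (rK z).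
Qed.

(** The estimate is termwise over the fibre. Only the values of [f] over [x] enter, so that [c] may
    depend on [x], as it does in [unit_cut]. *)
Lemma ptnorm_mult_le (f : Z -> Cplx R) u v x (c : R) : 0 <= c ->
  (forall z, s z = x -> Psi v z = f z *: Psi u z) ->
  (forall z, s z = x -> cabs (f z) <= c) -> ptnorm v x <= c * ptnorm u x.
Proof.
move=> c0 vfu fc; rewrite -(@ler_pXn2r _ 2)// ?nnegrE ?mulr_ge0 ?ptnorm_ge0//.
rewrite exprMn; suff : inner v v x <= (c ^+ 2)%:C%C * inner u u x.
  by rewrite !inner_ptnorm -rmorphM lecR.
rewrite !(giso_inner iso) !fsbig_finite/=; try exact: fibre_finite.
rewrite mulr_sumr big_seq [leRHS]big_seq; apply: ler_sum => z.
rewrite in_fset_set ?inE /=; last exact: fibre_finite.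
move=> zx; rewrite !hip_fibnorm -rmorphM lecR vfu// fibnormZ exprMn.
by rewrite ler_wpM2r ?sqr_ge0// ler_pXn2r ?nnegrE ?cabs_ge0// fc.
Qed.

Lemma mult_opnorm f T (c : R) : mult f T -> (forall z, cabs (f z) <= c) -> opnorm_le T c.
Proof.
move=> fT fc u; case: (leP 0 c) => c0.
  apply: hmnorm_le => [|x]; first by rewrite mulr_ge0 ?hmnorm_ge0.
  have := @ptnorm_mult_le f u (T u) x c c0 (fun z _ => fT u z) (fun z _ => fc z).
  by move/le_trans; apply; rewrite ler_wpM2l// ptnorm_le_hmnorm.
(* A negative bound on a modulus forces [Z] to be empty, and then [E] is zero. *)
have E0 w : w = 0.
  by apply: iso_ext => z; have := le_lt_trans (fc z) c0; rewrite ltNge cabs_ge0.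
by rewrite (E0 (T u)) (E0 u) hmnorm0 mulr0.
Qed.

Lemma mult_ge0 f T : mult f T -> (forall z, 0 <= f z) -> op_ge0 T.
Proof.
move=> fT f0 u x; rewrite (giso_inner iso) fsbig_finite/=; last exact: fibre_finite.
by apply: sumr_ge0 => z _; rewrite fT hipZr mulr_ge0// hip_ge0.
Qed.

(** Inner products vanish outside the image of [s], so the compact superlevel sets lie in that
    image, where properness applies. *)
Lemma proper_vanishing u : vanishing (fun z => ptnorm u (s z) ^+ 2).
Proof.
have [nc nv] := vanishing_ptnorm_sqr u; have [sc _] := sl.
split=> [z|e e0].
  by apply: (@continuous_comp _ _ _ s (fun x => ptnorm u x ^+ 2)); [exact: sc|exact: nc].
rewrite (_ : mkset _ = s @^-1` [set x | e <= ptnorm u x ^+ 2])//.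
apply: sp; first exact: nv.
move=> x /= ex; apply: contrapT => nx; move: ex.
rewrite -cabs_inner inner_vanish ?cabs0 ?leNgt ?e0// => z zx.
by exfalso; apply: nx; exists z.
Qed.

Lemma proper_C0 u v : C0 (fun z => inner u v (s z)).
Proof.
have [sc _] := sl.
apply: (C0_le (k := fun z => ptnorm u (s z) ^+ 2 + ptnorm v (s z) ^+ 2)).
- move=> z; apply: (@continuous_comp _ _ _ s (inner u v)); first exact: sc.
  by have [ic _] := inner_C0 u v; exact: ic.
- by apply: vanishingD; exact: proper_vanishing.
- move=> z; apply: le_trans (inner_CauchySchwarz u v (s z)) _.
  set a := ptnorm u _; set b := ptnorm v _.
  have a0 : 0 <= a := ptnorm_ge0 u _; have b0 : 0 <= b := ptnorm_ge0 v _.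
  by nra.
Qed.

Hypotheses (lcZ : locally_compact [set: Z]) (hZ : hausdorff_space Z) (Ll : line_bundle L).

Lemma cutoff_element z0 (O : set Z) (t : bundle_section L) : open O -> O z0 ->
  (forall z, O z -> scont_at t z) ->
  exists (u : E) (rho : Z -> R), [/\ forall z, 0 <= rho z <= 1,
    forall z, ~ O z -> rho z = 0, \forall z \near z0, rho z = 1 &
    forall z, Psi u z = (rho z)%:C%C *: t z].
Proof.
move=> Oo Oz tc; have [rho [r01 r0 r1 /(giso_surj iso)[u uE]]] := cutoff_section lcZ hZ Oo Oz tc.
by exists u, rho; split=> // z; rewrite uE.
Qed.

Lemma bump z0 (O : set Z) : open O -> O z0 -> exists u,
  [/\ slice_supported u, forall z, Psi u z != 0 -> O z,
      forall z, fibnorm (Psi u z) <= 1 & fibnorm (Psi u z0) = 1].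
Proof.
move=> Oo Oz; have [W [t [Wo Wz tP]]] := local_unit_section z0 Ll.
have [_ /(_ z0)[U [Uo Uz Ui _]]] := sl.
have Go : open (O `&` W `&` U) by apply: openI => //; exact: openI.
have [|u [rho [r01 r0 r1 uE]]] := cutoff_element (t := t) Go (conj (conj Oz Wz) Uz).
  by move=> z [[_ /tP[]]].
have uG z : Psi u z != 0 -> (O `&` W `&` U) z.
  by rewrite uE; apply: contraNP => /r0 ->; rewrite scale0r.
exists u; split.
- by move=> z z'; rewrite !inE /= => /uG[_ Uz'] /uG[_ Uz'']; apply: Ui; rewrite inE.
- by move=> z /uG[[]].
- move=> z; have /andP[rz0 rz1] := r01 z.
  have [/uG[[_ /tP[_ tz]] _]|] := boolP (Psi u z != 0).
    by rewrite uE fibnormZ tz mulr1 cabs_real ger0_norm.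
  by rewrite negbK => /eqP ->; rewrite fibnorm0.
- rewrite uE (nbhs_singleton r1) fibnormZ cabs_real normr1 mul1r.
  by have [] := tP z0 Wz.
Qed.

(** Norm one in [E], and not only at [z], is what bounds the diagonal coefficients of an operator by
    its norm. *)
Lemma exists_peaks : exists peak : Z -> E, forall z, [/\ slice_supported (peak z),
  fibnorm (Psi (peak z) z) = 1 & hmnorm (peak z) = 1].
Proof.
suff /choice[pk pkP] : forall z, exists u,
    [/\ slice_supported u, fibnorm (Psi u z) = 1 & hmnorm u = 1] by exists pk.
move=> z; have [u [us _ u1 uz]] := bump openT (I : [set: Z] z).
exists u; split=> //; apply/eqP; rewrite eq_le slice_hmnorm_le//=.
rewrite (le_trans _ (ptnorm_le_hmnorm u (s z)))//.
rewrite -(@ler_pXn2r _ 2)// ?nnegrE ?ptnorm_ge0// -cabs_inner.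
have uz0 : Psi u z != 0 by rewrite -fibnorm_eq0 uz oner_eq0.
by rewrite (inner_slice _ us uz0) hip_fibnorm uz cabs_real normrX normr1.
Qed.

Lemma fib_unit z (l v : fib L z) : fibnorm l = 1 -> v = hip l v *: l.
Proof.
move=> l1; have [l0 _ /(_ _)/cid H] := Ll z.
have [a lE] := H l; have [b vE] := H v.
have a0 : a != 0.
  by apply: contra_eq_neq l1 => a0; rewrite lE a0 scale0r fibnorm0 eq_sym oner_eq0.
have -> : v = (b / a) *: l by rewrite vE lE scalerA divfK.
by rewrite hipZr hip_fibnorm l1 expr1n mulr1.
Qed.

(** On a line, the rank-one operator defined by [l] and [l] is multiplication by the squared norm of
    [l]. *)
Lemma fib_swap z (l v : fib L z) : hip l v *: l = hip l l *: v.
Proof.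
have [->|l0] := eqVneq l 0; first by rewrite !hip0l scaler0 scale0r.
have n0 : fibnorm l != 0 by rewrite fibnorm_eq0.
have := @fib_unit z (((fibnorm l)^-1)%:C%C *: l) v.
rewrite fibnormZ cabs_real ger0_norm ?invr_ge0 ?fibnorm_ge0// mulVf// => /(_ erefl) {2}->.
rewrite hipZl !scalerA; congr (_ *: _).
rewrite hip_fibnorm conj_Creal ?complex_real// fmorphV rmorphXn /=.
have : (fibnorm l)%:C%C != 0 :> Cplx R by rewrite eq_complex /= eqxx andbT.
by move=> ?; field.
Qed.

End SectionModule.

(** * Diagonal coefficients of adjointable and compact operators *)

Section MultiplicationAlgebra.
Variables (R : realType) (X Z : topologicalType) (E : hilbert_module R X)
  (s : Z -> X) (L : herm_bundle R Z) (Psi : E -> bundle_section L).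
Hypotheses (iso : Gamma0_iso s Psi) (sl : local_homeomorphism s)
  (sp : proper_onto_image s) (lcZ : locally_compact [set: Z])
  (hZ : hausdorff_space Z) (Ll : line_bundle L).
Implicit Types (u v w : E) (x : X) (y z : Z).

Variable peak : Z -> E.
Hypothesis peakP : forall z, [/\ slice_supported s Psi (peak z),
  fibnorm (Psi (peak z) z) = 1 & hmnorm (peak z) = 1].

Notation mult := (mult Psi).
Notation concentrated := (concentrated s Psi).
Notation slice_supported := (slice_supported s Psi).

Lemma peak_neq0 z : Psi (peak z) z != 0.
Proof. by have [_ pz _] := peakP z; rewrite -fibnorm_eq0 pz oner_eq0. Qed.

Lemma peak_concentrated z : concentrated (peak z) z.
Proof. by have [ps _ _] := peakP z; apply: slice_concentrated => //; exact: peak_neq0. Qed.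

Lemma fib_peak z (v : fib L z) : v = hip (Psi (peak z) z) v *: Psi (peak z) z.
Proof. by have [_ pz _] := peakP z; exact: fib_unit. Qed.

Lemma cabs_hip_peak z (v : fib L z) : cabs (hip (Psi (peak z) z) v) = fibnorm v.
Proof. by have [_ pz _] := peakP z; rewrite {2}[v]fib_peak fibnormZ pz mulr1. Qed.

Lemma inner_peak v z : inner (peak z) v (s z) = hip (Psi (peak z) z) (Psi v z).
Proof. by apply: (inner_concentrated iso); exact: peak_concentrated. Qed.

(** Pairing with the peak isolates the component at [z]; Cauchy-Schwarz then compares it with the
    whole fibre sum. *)
Lemma fibnorm_le_ptnorm u z : fibnorm (Psi u z) <= ptnorm u (s z).
Proof.
rewrite -cabs_hip_peak -inner_peak (le_trans (inner_CauchySchwarz _ _ _))//.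
rewrite ler_piMl ?ptnorm_ge0//; have [_ _ <-] := peakP z.
exact: ptnorm_le_hmnorm.
Qed.

Lemma ptnorm_eq0P u x : ptnorm u x = 0 <-> forall z, s z = x -> Psi u z = 0.
Proof.
split=> [u0 z zx|u0]; last first.
  by apply/eqP; rewrite -sqrf_eq0 -cabs_inner (inner_vanish iso)// cabs0.
apply/eqP; rewrite -fibnorm_eq0 eq_le fibnorm_ge0 andbT.
by have := fibnorm_le_ptnorm u z; rewrite zx u0.
Qed.

(** This is the action of [T] on E_x: by [adjoint_local], [T (u - v)] has seminorm zero wherever
    [u - v] has. *)
Lemma adjointable_fibrewise T u v z : adjointable T ->
  (forall z', s z' = s z -> Psi u z' = Psi v z') -> Psi (T u) z = Psi (T v) z.
Proof.
move=> [T' TT'] uv; apply/eqP; rewrite -subr_eq0; apply/eqP.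
rewrite -(isoB iso) -adjointableB; last by exists T'.
apply: (ptnorm_eq0P _ _).1 (erefl (s z)); apply: (adjoint_local TT').
by apply/ptnorm_eq0P => z' sz'; rewrite (isoB iso) uv// subrr.
Qed.

(** The compression of T_x, [x = s z], to the line L_z. By [diag_coef_concentrated] any vector
    concentrated at [z] and nonzero there computes it, so the choice of the peak is immaterial. *)
Definition diag_coef (T : E -> E) z : Cplx R := inner (peak z) (T (peak z)) (s z).

Lemma diag_coefE T z : diag_coef T z = hip (Psi (peak z) z) (Psi (T (peak z)) z).
Proof. exact: inner_peak. Qed.

Lemma diag_coef_lin a S T z :
  diag_coef (a \*: S \+ T) z = a * diag_coef S z + diag_coef T z.
Proof. by rewrite /diag_coef innerPr. Qed.

Lemma diag_coefB S T z : diag_coef (S \- T) z = diag_coef S z - diag_coef T z.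
Proof. by rewrite /diag_coef /= innerDr innerNr. Qed.

Lemma diag_coef_mult f T z : mult f T -> diag_coef T z = f z.
Proof.
move=> fT; have [_ pz _] := peakP z.
by rewrite diag_coefE fT hipZr hip_fibnorm pz expr1n mulr1.
Qed.

Lemma diag_coef_le T (c : R) z : opnorm_le T c -> cabs (diag_coef T z) <= c.
Proof.
move=> Tc; have [_ _ pn] := peakP z.
apply: le_trans (inner_CauchySchwarz _ _ _) _.
apply: le_trans (_ : 1 * ptnorm (T (peak z)) (s z) <= _).
  by rewrite ler_wpM2r ?ptnorm_ge0// -pn ptnorm_le_hmnorm.
rewrite mul1r (le_trans (ptnorm_le_hmnorm _ _))//.
by rewrite (le_trans (Tc _))// pn mulr1.
Qed.

Lemma peak_agree u z : concentrated u z -> forall z', s z' = s z ->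
  Psi u z' = Psi (hip (Psi (peak z) z) (Psi u z) *: peak z) z'.
Proof.
move=> uz z' sz'; rewrite (isoZ iso); have [->|zz'] := pselect (z' = z).
  exact: fib_peak.
by rewrite (uz _ sz' zz') (peak_concentrated sz' zz') scaler0.
Qed.

Lemma diag_coef_concentrated T u z : adjointable T -> concentrated u z ->
  hip (Psi u z) (Psi (T u) z) = hip (Psi u z) (Psi u z) * diag_coef T z.
Proof.
move=> aT uz; rewrite (adjointable_fibrewise aT (peak_agree uz)).
set c := hip _ (Psi u z).
rewrite (adjointableZ _ _ aT) (isoZ iso).
rewrite [in LHS](fib_peak (Psi (T (peak z)) z)) -diag_coefE scalerA hipZr.
rewrite [c * _]mulrC -mulrA [RHS]mulrC; congr (_ * _).
by rewrite -hipZr -fib_peak.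
Qed.

Lemma near_peak_neq0 z0 : \forall z \near z0, fibnorm (Psi (peak z0) z) != 0.
Proof.
have [_ pz _] := peakP z0.
have fc := fibnorm_continuous (@iso_scont _ _ _ _ _ _ _ iso (peak z0) z0).
apply: (fc [set r | r != 0]); apply: open_nbhs_nbhs; split; first exact: open_neq.
by rewrite /= pz oner_eq0.
Qed.

(** [peak z] does not vary continuously with [z]. Near [z0] the single element [peak z0] is nonzero
    and, being supported on a slice, concentrated at each such [z]; it computes all nearby
    coefficients, after division by its squared norm. *)
Lemma diag_coef_continuous T : adjointable T -> continuous (diag_coef T).
Proof.
move=> aT z0; have [ps pz _] := peakP z0.
have sc u : scont_at (Psi u) z0 by exact: (iso_scont iso).
apply: (@continuous_near_eq _ _ (fun z =>
   hip (Psi (peak z0) z) (Psi (T (peak z0)) z) / hip (Psi (peak z0) z) (Psi (peak z0) z))).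
  apply: filterS (near_peak_neq0 z0) => z; rewrite fibnorm_eq0 => pz0.
  rewrite diag_coef_concentrated//; last exact: slice_concentrated.
  by rewrite mulrC mulKf// hip_eq0.
apply: cvgM; first exact: hip_continuous.
apply: cvgV; first by rewrite hip_eq0 peak_neq0.
exact: hip_continuous.
Qed.

Lemma diag_coef_rank1_le u v z :
  cabs (diag_coef (rank1 u v) z) <= hmnorm v * fibnorm (Psi u z).
Proof.
have [_ _ pn] := peakP z.
rewrite diag_coefE cabs_hip_peak /rank1 (iso_ract iso); last exact: inner_C0.
rewrite fibnormZ ler_wpM2r ?fibnorm_ge0//.
rewrite (le_trans (inner_CauchySchwarz _ _ _))//.
rewrite -[hmnorm v]mulr1 -pn ler_pM ?ptnorm_ge0 ?ptnorm_le_hmnorm//.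
Qed.

(** The coefficients of an operator within [e] of [T] are within [e] of those of [T], and the
    coefficients of a finite-rank operator are dominated by the fibre norms of the sections spanning
    its range. *)
Lemma diag_coef_C0 T : compact_op T -> C0 (diag_coef T).
Proof.
move=> [aT Tc]; apply: C0_approx; first exact: diag_coef_continuous.
move=> e /Tc[r Tr].
exists (fun z => \sum_(p <- r) hmnorm p.2 * fibnorm (Psi p.1 z)).
  apply: vanishing_sum => p; apply: vanishingZ; first exact: hmnorm_ge0.
  exact: (iso_fibnorm_vanishing iso).
move=> z; have := cabsD (diag_coef (T \- finite_rank_op r) z) (diag_coef (finite_rank_op r) z).
rewrite {1}diag_coefB subrK => /le_trans; apply; apply: lerD; first exact: diag_coef_le.
rewrite /diag_coef finite_rankE.
rewrite (form_sumr (fun a u v w => innerPr a u v w (s z))).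
apply: le_trans (cabs_sum _ _) _; apply: ler_sum => p _.
exact: diag_coef_rank1_le.
Qed.

(** Over the slice carrying [u] the inner product with [u] has one term, and [fib_swap] turns the
    rank-one operator of a line into a scalar. *)
Lemma mult_rank1 g G u : slice_supported u -> mult g G ->
  mult (fun z => g z * hip (Psi u z) (Psi u z)) (rank1 (G u) u).
Proof.
move=> us gG w z; rewrite /rank1 (iso_ract iso); last exact: inner_C0.
rewrite gG; have [->|uz] := eqVneq (Psi u z) 0.
  by rewrite !scaler0 hip0l mulr0 scale0r.
rewrite (inner_slice iso _ us uz) -[RHS]scalerA.
by rewrite -(fib_swap Ll (Psi u z) (Psi w z)) !scalerA [X in X *: _]mulrC.
Qed.

(* With sections u_j such that F = \sum_j |u_j|^2 >= 1/4 on {|f| >= e} and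
   g = f / max(F, 1/4), the operator \sum_j \theta_(g u_j, u_j) is M_(g F), and
   |f - g F| < e everywhere. *)
Lemma mult_finite_rank f T (e : R) : C0 f -> mult f T -> 0 < e ->
  exists r : seq (E * E), opnorm_le (T \- finite_rank_op r) e /\
    forall p, p \in r -> slice_supported p.1.
Proof.
move=> fC fT e0; have [fc fv] := fC.
(* A peak has norm 1 at its point, hence exceeds 1/2 on a neighbourhood; the threshold 1/4 for [F]
   is the square of 1/2. *)
pose W z := [set y | 2^-1 < fibnorm (Psi (peak z) y)].
have [|l lK lc] := compact_finite_cover (W := W) (fv _ e0).
  move=> z _; have [_ pz _] := peakP z.
  have pc := fibnorm_continuous (@iso_scont _ _ _ _ _ _ _ iso (peak z) z).
  apply: (pc [set r | 2^-1 < r]); apply: open_nbhs_nbhs; split; first exact: open_gt.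
  by rewrite /= pz invf_lt1 ?ltr1n.
pose F y := \sum_(z <- l) fibnorm (Psi (peak z) y) ^+ 2.
have F0 y : 0 <= F y by apply: sumr_ge0 => z _; rewrite sqr_ge0.
have Fc : continuous F.
  move=> y; apply: continuous_sum => z.
  have pc := fibnorm_continuous (@iso_scont _ _ _ _ _ _ _ iso (peak z) y).
  by apply: cvgM; exact: pc.
pose m y := (Num.max (F y) 4^-1)^-1.
have max0 y : 0 < Num.max (F y) 4^-1 by rewrite lt_max invr_gt0 ltr0n orbT.
have mc : continuous m.
  move=> y; apply: cvgV; first by rewrite gt_eqF.
  apply: (@continuous_max R Z F (cst 4^-1)); first exact: Fc.
  exact: cvg_cst.
have gC : C0 (fun y => f y * (m y)%:C%C).
  apply: (@C0_mulr R Z 4 f (fun y => (m y)%:C%C) fC) => y.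
    by apply: continuous_comp; [exact: mc|exact: realC_continuous].
  rewrite cabs_real ger0_norm ?invr_ge0 ?(ltW (max0 y))//.
  by rewrite -[leRHS]invrK lef_pV2 ?posrE// le_max lexx orbT.
have [G gG] := mult_C0_exists iso gC.
exists [seq (G (peak z), peak z) | z <- l]; split; last first.
  move=> p /mapP[z _ ->] /= z1 z2; rewrite !inE /= !gG !scaler_eq0 !negb_or.
  move=> /andP[_ h1] /andP[_ h2]; have [ps _ _] := peakP z.
  by apply: ps; rewrite inE.
have ps z : slice_supported (peak z) by have [] := peakP z.
have mS := mult_sum iso l (fun z => mult_rank1 (ps z) gG).
rewrite (_ : finite_rank_op _ = fun u => \sum_(z <- l) rank1 (G (peak z)) (peak z) u); last first.
  by apply/funext => u; rewrite finite_rankE big_map.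
apply: (mult_opnorm iso sl sp (multB iso fT mS)) => y.
rewrite -mulr_sumr.
have -> : \sum_(z <- l) hip (Psi (peak z) y) (Psi (peak z) y) = (F y)%:C%C :> Cplx R.
  by rewrite rmorph_sum; apply: eq_bigr => z _; rewrite hip_fibnorm.
rewrite -[f y in X in X - _]mulr1 -mulrA -mulrBr -rmorphM -(rmorph1 (real_complex R)) -rmorphB.
rewrite cabsM cabs_real.
have mF0 : 0 <= m y * F y by rewrite mulr_ge0 ?invr_ge0 ?(ltW (max0 y)).
have mF1 : m y * F y <= 1 by rewrite mulrC ler_pdivrMr// mul1r le_max lexx.
case: (leP e (cabs (f y))) => ef; last first.
  rewrite (le_trans _ (ltW ef))// ler_piMr ?cabs_ge0// ler_norml; lra.
have [z zl yz] := lc y ef.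
suff -> : m y * F y = 1 by rewrite subrr normr0 mulr0 ltW.
have F4 : 4^-1 <= F y.
  rewrite /F (big_rem z)//= (le_trans (y := fibnorm (Psi (peak z) y) ^+ 2))//.
    move: yz; rewrite /W /= => yz; have h : 2^-1 <= fibnorm (Psi (peak z) y) by exact: ltW.
    have -> : 4^-1 = 2^-1 ^+ 2 :> R by rewrite exprVn -natrX.
    by rewrite ler_pXn2r ?nnegrE ?fibnorm_ge0 ?invr_ge0.
  by rewrite lerDl; apply: sumr_ge0 => ? _; rewrite sqr_ge0.
by rewrite /m max_l// mulVf// gt_eqF// (lt_le_trans _ F4)// invr_gt0.
Qed.

Lemma mult_compact f T : C0 f -> mult f T -> compact_op T.
Proof.
move=> fC fT; split=> [|e e0]; last by have [r []] := mult_finite_rank fC fT e0; exists r.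
by have [S fS] := mult_C0_exists iso (C0_conj fC); exists S; exact: (mult_adjoint iso fT fS).
Qed.

(** Splitting a general [u] into concentrated parts is avoided by passing to the adjoint: [T'] also
    sends the peak at [z] to a vector concentrated at [z], so [<peak z, T u> = <T' (peak z), u>]
    depends only on the value of [u] at [z]. *)
Lemma compact_diagonal T : compact_op T ->
  (forall z u, concentrated u z -> concentrated (T u) z) -> mult (diag_coef T) T.
Proof.
move=> [aT _] Tc u z; have [T' TT'] := aT.
have T'c : concentrated (T' (peak z)) z.
  move=> z' sz' zz'; rewrite (fib_peak (Psi (T' (peak z)) z')) -inner_peak.
  rewrite -TT' (inner_concentrated iso); last by apply: Tc; exact: peak_concentrated.
  by rewrite (peak_concentrated sz' zz') hip0r scale0r.
have TE w : hip (Psi (peak z) z) (Psi (T w) z) = hip (Psi (T' (peak z)) z) (Psi w z).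
  rewrite -inner_peak -(inner_concentrated iso)//.
  by rewrite innerC TT' -innerC.
rewrite [LHS]fib_peak TE {1}[Psi u z]fib_peak hipZr -TE -diag_coefE.
by rewrite mulrC -scalerA -fib_peak.
Qed.

End MultiplicationAlgebra.

(** * The Cartan subalgebra of multiplication operators *)

Section CartanOfMultiplication.
Variables (R : realType) (X Z : topologicalType) (E : hilbert_module R X)
  (s : Z -> X) (L : herm_bundle R Z) (Psi : E -> bundle_section L).
Hypotheses (iso : Gamma0_iso s Psi) (sl : local_homeomorphism s)
  (sp : proper_onto_image s) (lcZ : locally_compact [set: Z])
  (hZ : hausdorff_space Z) (Ll : line_bundle L).
Implicit Types (u v w : E) (x : X) (y z : Z).

Variable peak : Z -> E.
Hypothesis peakP : forall z, [/\ slice_supported s Psi (peak z),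
  fibnorm (Psi (peak z) z) = 1 & hmnorm (peak z) = 1].

Notation mult := (mult Psi).
Notation concentrated := (concentrated s Psi).
Notation slice_supported := (slice_supported s Psi).
Notation diag_coef := (diag_coef s peak).

Definition mult_algebra : set (E -> E) := [set T | exists2 f, C0 f & mult f T].

Lemma mult_algebra_compact : mult_algebra `<=` compact_op (E := E).
Proof. by move=> T [f fC fT]; exact: (mult_compact iso sl sp Ll peakP fC fT). Qed.

Lemma mult_algebra_Cstar : Cstar_subalgebra mult_algebra.
Proof.
split.
- by move=> T /mult_algebra_compact[].
- exists (fun=> 0); first exact: C0_const0.
  by move=> u z; rewrite (iso0 iso) scale0r.
- move=> a S T [f fC fS] [g gC gT].
  by exists (fun z => a * f z + g z); [exact: C0_lin|exact: (mult_lin iso)].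
- move=> S T [f fC fS] [g gC gT].
  by exists (fun z => f z * g z); [exact: C0M|exact: mult_comp].
- move=> T T' [f fC fT] TT'.
  have [S fS] := mult_C0_exists iso (C0_conj fC).
  rewrite (is_adjoint_unique TT' (mult_adjoint iso fT fS)).
  by exists (fun z => (f z)^*) => //; exact: C0_conj.
(* If [T] is close to multiplication by [g], its coefficients are uniformly close to [g]. Hence they
   form a C_0 function, and multiplication by this function differs from [T] on [u] by at most twice
   [e] times the norm of [u], for every [e]. *)
- move=> T aT TD.
  have near_coef e S g : mult g S -> opnorm_le (T \- S) e ->
      forall z, cabs (diag_coef T z - g z) <= e.
    move=> gS TS z; rewrite -(diag_coef_mult iso peakP z gS) -diag_coefB.
    exact: (diag_coef_le peakP).
  exists (diag_coef T).
    apply: C0_approx; first exact: (diag_coef_continuous iso Ll peakP aT).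
    move=> e /TD[S [g gC gS] TS]; exists (fun z => cabs (g z)); first exact: C0_vanishing.
    move=> z; have := cabsD (diag_coef T z - g z) (g z); rewrite subrK => /le_trans; apply.
    by rewrite lerD2r; exact: near_coef gS TS z.
  move=> u z; apply/eqP; rewrite -subr_eq0 -fibnorm_eq0 eq_le fibnorm_ge0 andbT.
  apply: (@le_eps0 _ _ (hmnorm u + hmnorm u)); first by rewrite addr_ge0 ?hmnorm_ge0.
  move=> e /TD[S [g gC gS] TS].
  have -> : Psi (T u) z - diag_coef T z *: Psi u z =
      Psi ((T \- S) u) z + (- (diag_coef T z - g z)) *: Psi u z.
    by rewrite /= (isoB iso) gS opprB scalerBl addrA subrK.
  have le1 w : fibnorm (Psi w z) <= hmnorm w.
    exact: le_trans (fibnorm_le_ptnorm iso Ll peakP w z) (ptnorm_le_hmnorm _ _).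
  rewrite (le_trans (fibnormD _ _))// mulrDr lerD//.
    exact: le_trans (le1 _) (TS u).
  by rewrite fibnormZ cabsN ler_pM ?cabs_ge0 ?fibnorm_ge0//; exact: near_coef gS TS z.
Qed.

Lemma mult_algebra_commuting : pairwise_commuting mult_algebra.
Proof.
move=> S T [f _ fS] [g _ gT].
apply: (mult_unique iso (mult_comp fS gT)) => u z.
by rewrite (mult_comp gT fS) mulrC.
Qed.

(** Let [u] be concentrated at [z] and [z'] another point over [s z]. Multiplication by the squared
    norm of a bump at [z'] that vanishes at [z] annihilates [u] over [s z] and is the identity at
    [z']. Commuting with it forces [T u] to vanish at [z']. *)
Lemma mult_algebra_maximal : maximal_abelian (compact_op (E := E)) mult_algebra.
Proof.
split; [exact: mult_algebra_Cstar|exact: mult_algebra_compact|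
        exact: mult_algebra_commuting|].
move=> D' _ D'K D'c DD'; apply/seteqP; split=> // T D'T.
have Tc := D'K _ D'T; have [aT _] := Tc.
exists (diag_coef T); first exact: (diag_coef_C0 iso Ll peakP Tc).
apply: (compact_diagonal iso Ll peakP Tc) => z u uz z' sz' zz'.
have zo : open (~` [set z]).
  by apply: closed_openC; apply: accessible_closed_set1; exact: hausdorff_accessible.
have [v [_ vO _ vz']] := bump iso sl lcZ hZ Ll zo zz'.
have fC : C0 (fun y => hip (Psi v y) (Psi v y)).
  by apply: Gamma0_C0; exact: giso_Gamma0 iso v.
have [M fM] := mult_C0_exists iso fC.
have MD : mult_algebra M by exists (fun y => hip (Psi v y) (Psi v y)).
have := congr1 (fun A => Psi (A u) z') (D'c _ _ (DD' _ MD) D'T).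
rewrite /= fM hip_fibnorm vz' expr1n scale1r => ->.
rewrite (adjointable_fibrewise iso Ll peakP (v := 0) aT) ?adjointable0 ?(iso0 iso)//.
move=> y sy; rewrite fM (iso0 iso); have [->|yz] := pselect (y = z).
  have [/eqP vz|/vO/=//] := boolP (Psi v z == 0).
  by rewrite vz hip0l scale0r.
by rewrite uz ?scaler0// sy.
Qed.

(* f0 is constant along the fibres of s: pulling back a function on X controls
   the norm of E, a supremum of sums over fibres of unbounded cardinality. *)
Lemma unit_cut (r : seq E) (d : R) : 0 < d -> exists f0 : Z -> R,
  [/\ vanishing f0, forall z, 0 <= f0 z <= 1 &
    forall (f : Z -> R) M u, (forall z, f0 z <= f z <= 1) -> u \in r ->
      mult (fun z => (1 - f z)%:C%C) M -> hmnorm (M u) <= d].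
Proof.
move=> d0; pose G x := \sum_(u <- r) ptnorm u x ^+ 2.
have G0 x : 0 <= G x by apply: sumr_ge0 => u _; rewrite sqr_ge0.
have Gv : vanishing (fun z => d ^- 2 * G (s z)).
  apply: vanishingZ; first by rewrite invr_ge0 sqr_ge0.
  by apply: vanishing_sum => u; exact: (proper_vanishing iso sl sp).
have dG0 x : 0 <= d ^- 2 * G x by rewrite mulr_ge0 ?invr_ge0 ?sqr_ge0.
exists (fun z => Num.min 1 (d ^- 2 * G (s z))); split.
- apply: (vanishing_le _ Gv) => [z|z]; last by rewrite ge_min lexx orbT.
  apply: (@continuous_min R Z (cst 1)); first exact: cvg_cst.
  exact: Gv.1.
- by move=> z; rewrite le_min ler01 dG0 ge_min lexx.
move=> f M u f0 ur fM; apply: hmnorm_le => [|x]; first exact: ltW.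
have c0 : 0 <= 1 - Num.min 1 (d ^- 2 * G x) by rewrite subr_ge0 ge_min lexx.
apply: le_trans (ptnorm_mult_le (f := fun z => (1 - f z)%:C%C) (u := u) iso sl sp c0 _ _) _.
- by move=> z _; rewrite fM.
- move=> z <-; have /andP[fl fu] := f0 z.
  by rewrite cabs_real ger0_norm ?subr_ge0// lerD2l lerN2.
have [G1|G1] := leP 1 (d ^- 2 * G x); first by rewrite subrr mul0r ltW.
have : ptnorm u x <= d.
  rewrite -(@ler_pXn2r _ 2)// ?nnegrE ?ptnorm_ge0 ?(ltW d0)//.
  apply: (@le_trans _ _ (G x)); last first.
    by move: G1; rewrite mulrC ltr_pdivrMr ?exprn_gt0// mul1r => /ltW.
  by rewrite /G (big_rem u)//= lerDl; apply: sumr_ge0 => ? _; rewrite sqr_ge0.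
apply: le_trans; rewrite ler_piMl ?ptnorm_ge0//.
by rewrite lerBlDr lerDl.
Qed.

(** [u] is close to [T u] for a suitable cut-off multiplication [T], and [T] is close in norm to a
    finite-rank operator whose range is spanned by elements supported on slices. No partition of
    unity is required. *)
Lemma slice_dense u (e : R) : 0 < e -> exists r : seq E,
  (forall v, v \in r -> slice_supported v) /\ hmnorm (u - \sum_(v <- r) v) <= e.
Proof.
move=> e0; have e2 : 0 < e / 2 by rewrite divr_gt0.
have [f [fv f01 fP]] := unit_cut [:: u] e2.
have fC : C0 (fun z => (f z)%:C%C : Cplx R).
  by apply: C0_real => // z; have /andP[] := f01 z.
have [T fT] := mult_C0_exists iso fC.
have Tu : hmnorm (u - T u) <= e / 2.
  apply: (fP f (fun w => w - T w)); [|by rewrite inE|].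
    by move=> z; have /andP[_ ->] := f01 z; rewrite lexx.
  by move=> w z; rewrite (isoB iso) fT rmorphB rmorph1 scalerBl scale1r.
have u1 : 0 < hmnorm u + 1 by rewrite ltr_wpDl ?hmnorm_ge0.
have [r [Tr rs]] := mult_finite_rank iso sl sp Ll peakP fC fT (divr_gt0 e2 u1).
exists [seq rank1 p.1 p.2 u | p <- r]; split.
  by move=> v /mapP[p /rs ps ->]; apply: (slice_ract iso) => //; exact: inner_C0.
rewrite big_map -finite_rankE -[u in u - _](subrK (T u)) -addrA.
rewrite (le_trans (hmnormD _ _))// [leRHS]splitr lerD//.
apply: le_trans (Tr u) _.
by rewrite -mulrA ler_piMr ?(ltW e2)// mulrC ler_pdivrMr// mul1r lerDl.
Qed.

Lemma opnorm_le_rank1B u u' v : opnorm_le (rank1 u v \- rank1 u' v) (hmnorm (u - u') * hmnorm v).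
Proof.
move=> w; rewrite (_ : (_ \- _) w = rank1 (u - u') v w); first exact: opnorm_rank1.
rewrite /rank1 /=; have iC := inner_C0 v w.
by rewrite addrC -scaleN1r [u - u']addrC -scaleN1r ractPl.
Qed.

(** All C_0 functions with values in [0, 1], ordered pointwise, index the unit. For a given compact
    operator, a finite-rank approximation leaves finitely many vectors on which [1 - e_j] has to be
    small; [unit_cut] supplies an index beyond which it is. *)
Lemma mult_algebra_unit : contains_approximate_unit (compact_op (E := E)) mult_algebra.
Proof.
pose J := {f : Z -> R | vanishing f /\ forall z, 0 <= f z <= 1}.
pose fn (j : J) := sval j.
have jv j : vanishing (fn j) by have [] := svalP j.
have j01 j z : 0 <= fn j z <= 1 by have [_] := svalP j; apply.
have jC j : C0 (fun z => (fn j z)%:C%C : Cplx R).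
  by apply: C0_real => // z; have /andP[] := j01 j z.
have /choice[e_ eP] : forall j : J, exists T, mult (fun z => (fn j z)%:C%C) T.
  by move=> j; exact: (mult_C0_exists iso (jC j)).
have J0 : J by exists (fun=> 0); split; [exact: vanishing0|move=> z; rewrite lexx ler01].
exists J, (fun i j => forall z, fn i z <= fn j z), e_; split.
  split=> //.
  - by move=> i j k ij jk z; exact: le_trans (jk z).
  - move=> i j.
    have mv : vanishing (fun z => Num.max (fn i z) (fn j z)) /\
        forall z, 0 <= Num.max (fn i z) (fn j z) <= 1.
      split=> [|z]; last first.
        move: (j01 i z) (j01 j z) => /andP[a b] /andP[c d].
        by rewrite le_max a ge_max b d.
      apply: (vanishing_le _ (vanishingD (jv i) (jv j))) => [z|z].
        by apply: (@continuous_max R Z); [exact: (jv i).1|exact: (jv j).1].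
      move: (j01 i z) (j01 j z) => /andP[a b] /andP[c d].
      by rewrite ge_max lerDl c lerDr a.
    pose P (f : Z -> R) := vanishing f /\ forall z, 0 <= f z <= 1.
    by exists (exist P _ mv); split=> z; rewrite /fn /= le_max lexx ?orbT.
split.
- by move=> j; exists (fun z => (fn j z)%:C%C).
- move=> j; split.
    by apply: (mult_ge0 iso sl sp (eP j)) => z; rewrite ler0c; have /andP[] := j01 j z.
  apply: (mult_opnorm iso sl sp (eP j)) => z; have /andP[a b] := j01 j z.
  by rewrite cabs_real ger0_norm.
- move=> i j ij; apply: (mult_ge0 iso sl sp (multB iso (eP j) (eP i))) => z.
  by rewrite -rmorphB ler0c subr_ge0.
move=> T [aT Tc] e e0; have e2 : 0 < e / 2 by rewrite divr_gt0.
have [r Tr] := Tc _ e2.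
pose n := \sum_(p <- r) (hmnorm p.1 + hmnorm p.2).
have n0 : 0 <= n by apply: sumr_ge0 => p _; rewrite addr_ge0 ?hmnorm_ge0.
have n1 : 0 < n + 1 by rewrite ltr_wpDl.
(* Each rank-one term contributes at most [d] times the norm of one of its two vectors, so the total
   stays below [e / 2]. *)
pose d := e / 2 / (n + 1); have d0 : 0 < d by rewrite divr_gt0.
have dn : n * d <= e / 2.
  by rewrite /d mulrCA ler_piMr ?(ltW e2)// ler_pdivrMr// mul1r lerDl.
have [f0 [f0v f001 f0P]] := unit_cut ([seq p.1 | p <- r] ++ [seq p.2 | p <- r]) d0.
exists (exist _ f0 (conj f0v f001)) => j jf.
pose M := fun w => w - e_ j w.
have fM : mult (fun z => (1 - fn j z)%:C%C) M.
  by move=> w z; rewrite (isoB iso) eP rmorphB rmorph1 scalerBl scale1r.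
have M1 : opnorm_le M 1.
  apply: (mult_opnorm iso sl sp fM) => z; have /andP[a b] := j01 j z.
  by rewrite cabs_real ger0_norm ?subr_ge0// lerBlDr lerDl.
have MM : is_adjoint M M.
  apply: (mult_adjoint iso fM) => w z; rewrite fM; congr (_ *: _).
  by rewrite conj_Creal// complex_real.
have Mr p : p \in r -> hmnorm (M p.1) <= d /\ hmnorm (M p.2) <= d.
  move=> pr; split; apply: (f0P (fn j)) => //; try by move=> z; rewrite jf; have /andP[] := j01 j z.
    by rewrite mem_cat map_f.
  by rewrite mem_cat map_f ?orbT.
have M0 u : hmnorm (M u) <= hmnorm u by rewrite -[leRHS]mul1r; exact: M1.
split.
  have -> : T \o e_ j \- T = fun w => - T (M w).
    by apply/funext => w; rewrite /M /= (adjointableB _ _ aT) opprB.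
  have SM : opnorm_le (finite_rank_op r \o M) (e / 2).
    move=> w; apply: le_trans (_ : n * d * hmnorm w <= _); last by rewrite ler_wpM2r ?hmnorm_ge0.
    rewrite /= finite_rankE (le_trans (hmnorm_sum _ _))// /n !mulr_suml big_seq [leRHS]big_seq.
    apply: ler_sum => p pr; have [_ Mp] := Mr p pr.
    (* Since [M] is selfadjoint, composing on the right moves it onto the second vector of the
       rank-one operator. *)
    have -> : rank1 p.1 p.2 (M w) = rank1 p.1 (M p.2) w.
      by rewrite /rank1; congr (ract _ _); apply/funext => x; rewrite MM.
    apply: le_trans (opnorm_rank1 _ _ _) _; rewrite ler_wpM2r ?hmnorm_ge0//.
    by rewrite ler_pM ?hmnorm_ge0// lerDl hmnorm_ge0.
  move=> w; rewrite hmnormN -(subrK (finite_rank_op r (M w)) (T (M w))).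
  rewrite (le_trans (hmnormD _ _))// [e]splitr mulrDl lerD//; last exact: SM.
  by apply: le_trans (Tr (M w)) _; rewrite ler_wpM2l ?(ltW e2).
have -> : e_ j \o T \- T = fun w => - M (T w) by apply/funext => w; rewrite /M /= opprB.
have MS : opnorm_le (M \o finite_rank_op r) (e / 2).
  move=> w; apply: le_trans (_ : n * d * hmnorm w <= _); last by rewrite ler_wpM2r ?hmnorm_ge0.
  have -> : (M \o finite_rank_op r) w = \sum_(p <- r) rank1 (M p.1) p.2 w.
    apply: (iso_ext iso) => z; rewrite /= fM finite_rankE !(iso_sum iso) scaler_sumr.
    apply: eq_bigr => p _; rewrite !(iso_ract iso) ?fM; try exact: inner_C0.
    by rewrite !scalerA mulrC.
  rewrite (le_trans (hmnorm_sum _ _))// /n !mulr_suml big_seq [leRHS]big_seq.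
  apply: ler_sum => p pr; have [Mp _] := Mr p pr.
  apply: le_trans (opnorm_rank1 _ _ _) _; rewrite ler_wpM2r ?hmnorm_ge0// mulrC.
  by rewrite ler_pM ?hmnorm_ge0// lerDr hmnorm_ge0.
move=> w; have MB u v : M (u - v) = M u - M v.
  have aM : adjointable M by exists M.
  by rewrite (adjointableB _ _ aM).
rewrite hmnormN -(subrK (M (finite_rank_op r w)) (M (T w))) -MB.
rewrite (le_trans (hmnormD _ _))// [e]splitr mulrDl lerD//; last exact: MS.
exact: le_trans (M0 _) (Tr w).
Qed.

(** With [a] the left vector, the conjugated operator is [w |-> a <b, T b> <a, w>], of the form
    covered by [mult_rank1]. The roles of [u] and [v] are exchanged for the adjoint. *)
Lemma slice_normalizer u v : slice_supported u -> slice_supported v ->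
  normalizer_set (compact_op (E := E)) mult_algebra (rank1 u v).
Proof.
have half a b T : slice_supported a -> mult_algebra T ->
    mult_algebra (rank1 a b \o T \o rank1 b a).
  move=> as_ TD; have [aT _] := mult_algebra_compact TD.
  exists (fun z => inner b (T b) (s z) * hip (Psi a z) (Psi a z)).
    apply: C0M; first exact: (proper_C0 iso sl sp).
    by apply: Gamma0_C0; exact: giso_Gamma0 iso a.
  have [G bG] := mult_C0_exists iso (proper_C0 iso sl sp b (T b)).
  move=> w z; rewrite -(mult_rank1 iso Ll as_ bG).
  rewrite !(iso_ract iso) ?bG; try exact: inner_C0.
  rewrite scalerA; congr (_ *: _); rewrite /=.
  have [T' TT'] := aT; rewrite -(is_adjoint_sym TT') inner_ract; last exact: inner_C0.
  by rewrite (is_adjoint_sym TT') mulrC.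
move=> us vs; split; first exact: compact_rank1.
move=> N' T NN' TD; rewrite -(is_adjoint_unique (is_adjoint_rank1 u v) NN').
by split; exact: half.
Qed.

(** Rank-one operators with both vectors supported on slices are normalizers. Density of sums of
    such elements is used once in each slot: the first slot directly, the second after taking
    adjoints. *)
Lemma mult_algebra_regular : Cstar_generates (compact_op (E := E))
  (normalizer_set (compact_op (E := E)) mult_algebra).
Proof.
split=> [T []//|B Bc nB T [aT Tc]].
have B0 := csub0 Bc.
have BD S1 S2 : B S1 -> B S2 -> B (fun w => S1 w + S2 w).
  move=> b1 b2; have := csubP Bc 1 b1 b2.
  by congr B; apply/funext => w /=; rewrite scale1r.
have Bsum (I : eqType) (r : seq I) (F : I -> E -> E) : (forall i, i \in r -> B (F i)) ->
    B (fun w => \sum_(i <- r) F i w).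
  elim: r => [|i r IH] BF; first by under eq_fun do rewrite big_nil.
  under eq_fun do rewrite big_cons; apply: BD; first by apply: BF; rewrite mem_head.
  by apply: IH => k kr; apply: BF; rewrite inE kr orbT.
have rank1_suml (r : seq E) v w : rank1 (\sum_(u <- r) u) v w = \sum_(u <- r) rank1 u v w.
  rewrite /rank1; have iC := inner_C0 v w; elim: r => [|u r IH].
    by rewrite !big_nil; have := @ractPl _ _ E (-1) 0 0 _ iC; rewrite scaler0 addr0 scaleN1r addNr.
  by rewrite !big_cons -IH -[u in LHS]scale1r ractPl// scale1r.
have approx u v : (forall r : seq E, (forall a, a \in r -> slice_supported a) ->
    B (rank1 (\sum_(a <- r) a) v)) -> B (rank1 u v).
  move=> H; apply: (csub_closed Bc); first by exists (rank1 v u); exact: is_adjoint_rank1.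
  move=> e e0; have v1 : 0 < hmnorm v + 1 by rewrite ltr_wpDl ?hmnorm_ge0.
  have [r [rs ru]] := slice_dense u (divr_gt0 e0 v1).
  exists (rank1 (\sum_(a <- r) a) v); first exact: H.
  apply: opnorm_leW (opnorm_le_rank1B _ _ _).
  apply: le_trans (ler_wpM2r (hmnorm_ge0 v) ru) _.
  by rewrite -mulrA ler_piMr ?(ltW e0)// mulrC ler_pdivrMr// mul1r lerDl.
have Bslice u v : slice_supported v -> B (rank1 u v).
  move=> vs; apply: approx => r rs.
  rewrite (_ : rank1 _ v = fun w => \sum_(a <- r) rank1 a v w); last first.
    by apply/funext => w; exact: rank1_suml.
  by apply: Bsum => a ar; apply: nB; apply: slice_normalizer => //; exact: rs.
have Badj u v : B (rank1 u v) -> B (rank1 v u).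
  by move=> Buv; apply: (csub_adj Bc Buv); exact: is_adjoint_rank1.
have Brank1 u v : B (rank1 u v).
  apply: approx => r rs.
  rewrite (_ : rank1 _ v = fun w => \sum_(a <- r) rank1 a v w); last first.
    by apply/funext => w; exact: rank1_suml.
  by apply: Bsum => a ar; apply: Badj; apply: Bslice; exact: rs.
apply: (csub_closed Bc) => // e /Tc[r Tr].
exists (finite_rank_op r) => //.
by apply: (Bsum _ r (fun p => rank1 p.1 p.2)) => p _; exact: Brank1.
Qed.

(* The value P T := T when the diagonal coefficients of T are not in C_0(Z) is
   junk, chosen so that faithfulness holds without knowing that T' T is
   compact. *)
Lemma mult_algebra_expectation : exists P,
  faithful_expectation (compact_op (E := E)) mult_algebra P.
Proof.
have /choice[P PE] : forall T : E -> E, exists S : E -> E,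
    (C0 (diag_coef T) -> mult (diag_coef T) S) /\ (~ C0 (diag_coef T) -> S = T).
  move=> T; have [TC|nTC] := pselect (C0 (diag_coef T)); last by exists T.
  by have [S TS] := mult_C0_exists iso TC; exists S.
have PK T : compact_op T -> mult (diag_coef T) (P T).
  by move=> /(diag_coef_C0 iso Ll peakP) TC; exact: (PE T).1.
have eq_mult f g S S' : mult f S -> mult g S' -> (forall z, f z = g z) -> S = S'.
  by move=> fS gS fg; apply: (mult_unique iso fS) => u z; rewrite gS fg.
have DK := mult_algebra_compact.
exists P; split.
- by move=> T TK; exists (diag_coef T); [exact: (diag_coef_C0 iso Ll peakP)|exact: PK].
- move=> T TD; have [f fC fT] := TD.
  apply: (eq_mult _ _ _ _ (PK T (DK _ TD)) fT) => z; exact: (diag_coef_mult iso peakP).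
- move=> a T S TK SK.
  (* This excludes the junk value of [P] without appealing to compactness of the combination. *)
  have TSC : C0 (diag_coef (a \*: T \+ S)).
    rewrite (_ : diag_coef _ = fun z => a * diag_coef T z + diag_coef S z).
      by apply: C0_lin; exact: (diag_coef_C0 iso Ll peakP).
    by apply/funext => z; exact: diag_coef_lin.
  apply: (eq_mult _ _ _ _ ((PE _).1 TSC) (mult_lin iso a (PK T TK) (PK S SK))) => z.
  exact: diag_coef_lin.
- move=> T d d' TK [f fC fd] [g gC gd].
  have coefE z : diag_coef (d \o T \o d') z = f z * diag_coef T z * g z.
    rewrite !(diag_coefE iso peakP) /= fd hipZr -mulrA; congr (_ * _).
    rewrite (adjointable_fibrewise iso Ll peakP (v := g z *: peak z) TK.1); last first.
      move=> z' sz'; rewrite gd (isoZ iso); have [->//|zz'] := pselect (z' = z).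
      by rewrite (peak_concentrated peakP sz' zz') !scaler0.
    by rewrite (adjointableZ _ _ TK.1) (isoZ iso) hipZr mulrC.
  have dTC : C0 (diag_coef (d \o T \o d')).
    rewrite (_ : diag_coef _ = fun z => f z * diag_coef T z * g z); last exact/funext.
    by apply: C0M => //; apply: C0M => //; exact: (diag_coef_C0 iso Ll peakP).
  exact: (eq_mult _ _ _ _ ((PE _).1 dTC) (mult_comp (mult_comp fd (PK T TK)) gd)).
- by move=> T TK T0; apply: (mult_ge0 iso sl sp (PK T TK)) => z; exact: T0.
- by move=> T c TK Tc; apply: (mult_opnorm iso sl sp (PK T TK)) => z; exact: (diag_coef_le peakP).
- move=> T T' TK TT' PT0.
  have T'T z : diag_coef (T' \o T) z = inner (T (peak z)) (T (peak z)) (s z).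
    by rewrite TT'.
  have [TC|/(PE _).2 e] := pselect (C0 (diag_coef (T' \o T))); last first.
    (* In the junk case [P] fixes [T' T], which is therefore zero, and [<Tu, Tu> = <u, T' T u>]. *)
    apply/funext => u; apply: inner_eq0 => x; rewrite TT'.
    have := congr1 (fun A => A u) (etrans (esym e) PT0); rewrite /= => ->.
    exact: inner0r.
  have a0 z : diag_coef (T' \o T) z = 0.
    rewrite -(diag_coef_mult iso peakP z ((PE _).1 TC)) PT0.
    exact: inner0r.
  (* The vanishing coefficients say that [T (peak z)] is null over [s z]; hence
     [<peak z, T' v> = <T (peak z), v>] vanishes there for every [z]. *)
  have T'0 v : T' v = 0.
    apply: (iso_ext iso) => z; rewrite (iso0 iso) (fib_peak Ll peakP (Psi (T' v) z)).
    rewrite -(inner_peak iso peakP) -TT' inner_eq0l ?scale0r//.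
    by apply/eqP; rewrite -sqrf_eq0 -cabs_inner -T'T a0 cabs0.
  apply/funext => u; apply: inner_inj => w x.
  by rewrite TT' T'0 inner0r (inner_eq0l _ (ptnorm0 _ _)).
Qed.

Lemma mult_algebra_Cartan : Cartan_subalgebra (compact_op (E := E)) mult_algebra.
Proof.
split; [exact: mult_algebra_maximal|exact: mult_algebra_unit|
        exact: mult_algebra_regular|exact: mult_algebra_expectation].
Qed.

End CartanOfMultiplication.

(** * Charts *)

Section OpenSubspace.
Variables (X : topologicalType) (U : set X).
Hypothesis openU : open U.

Lemma set_val_continuous : continuous (set_val : U -> X).
Proof. exact: initial_continuous. Qed.

Lemma set_val_exists x : U x -> exists b : U, set_val b = x.
Proof. by move=> Ux; exists (SigSub (mem_set Ux)). Qed.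

Lemma set_val_in (b : U) : U (set_val b).
Proof. exact: set_valP. Qed.

Lemma open_set_val (O : set U) : open O -> open (set_val @` O).
Proof.
move=> [W Wo WO]; rewrite (_ : _ @` _ = W `&` U); first exact: openI.
apply/seteqP; split=> [_ [b Ob <-]|x [Wx Ux]].
  by split; [move: Ob; rewrite -WO|exact: set_val_in].
by have [b bx] := set_val_exists Ux; exists b => //; rewrite -WO /= bx.
Qed.

Lemma nbhs_set_val (b : U) (N : set U) : nbhs b N -> nbhs (set_val b) (set_val @` N).
Proof.
rewrite (@nbhsE _ b) => -[W [Wo Wb] WN].
have : nbhs (set_val b) (set_val @` W).
  by apply: open_nbhs_nbhs; split; [exact: open_set_val|exists b].
by apply: filterS => _ [a Wa <-]; exists a; [exact: WN|].
Qed.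

Lemma compact_set_val (K : set X) : K `<=` U -> compact K ->
  compact (set_val @^-1` K : set U).
Proof.
move=> KU Kc F FF FK.
have [x [Kx xF]] := Kc (set_val @ F) _ FK.
have [b bx] := set_val_exists (KU _ Kx).
exists b; split; first by rewrite /= bx.
move=> A N FA /nbhs_set_val; rewrite bx => Nx.
have FA' : (set_val @ F) (set_val @` A).
  suff : F (fun a => (set_val @` A) (set_val a)) by [].
  by apply: filterS FA => a Aa; exists a.
by have [_ [[a Aa <-] [a' Na' /val_inj aa']]] := xF _ _ FA' Nx; exists a; split=> //; rewrite -aa'.
Qed.

Hypotheses (hX : hausdorff_space X) (lcX : locally_compact [set: X]).

Lemma open_hausdorff_subspace : hausdorff_space U.
Proof.
move=> p q pq; apply: val_inj; apply: hX => A B pA qB.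
have [b [Ab Bb]] := pq _ _ (set_val_continuous pA) (set_val_continuous qB).
by exists (set_val b).
Qed.

Lemma open_locally_compact : locally_compact [set: U].
Proof.
move=> b _; rewrite withinET.
have [K [Kc KU Kb]] := compact_nbhs_in lcX hX (open_nbhs_nbhs (conj openU (set_val_in b))).
exists (set_val @^-1` K); first exact: set_val_continuous.
have Kc' : compact (set_val @^-1` K : set U) by exact: compact_set_val.
by split=> //; apply: compact_closed => //; exact: open_hausdorff_subspace.
Qed.

End OpenSubspace.

Lemma local_homeomorphism_open (Z X : topologicalType) (s : Z -> X) (O : set Z) :
  local_homeomorphism s -> open O -> open (s @` O).
Proof.
move=> [_ sl] Oo; rewrite openE => _ [z Oz <-].
have [U [Uo Uz _ Us]] := sl z.
have : open (s @` (O `&` U)) by apply: Us => //; exact: openI.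
rewrite openE => /(_ (s z)); rewrite /interior => H.
by apply: filterS (H _) => [_ [y [Oy _] <-]|]; [exists y|exists z].
Qed.

Section FrameTrivialization.
Variables (R : realType) (B : topologicalType) (V : herm_bundle R B).
Variables (n : nat) (W : set B) (h : forall b, 'cV[Cplx R]_n -> fib V b).
Hypotheses (Wo : open W) (hl : forall b, W b -> linear (h b))
  (hs : forall b, W b -> forall v, exists a, v = h b a)
  (hi : forall b, W b -> forall v w,
    hip (h b v) (h b w) = \sum_k (v k 0)^* * w k 0)
  (hc : forall b k, W b -> scont_at (fun y => h y (basis_vec R k)) b).

Lemma isometric_basis b k (w : 'cV[Cplx R]_n) : W b ->
  hip (h b (basis_vec R k)) (h b w) = w k 0.
Proof.
move=> Wb; rewrite hi// (bigD1 k)//= big1 ?addr0 => [|l lk].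
  by rewrite !mxE !eqxx conjC1 mul1r.
by rewrite !mxE (negbTE lk) conjC0 mul0r.
Qed.

Lemma isometric_bijective b : W b -> bijective (h b).
Proof.
move=> Wb; exists (fun v => \col_k hip (h b (basis_vec R k)) v) => [w|v].
  by apply/colP => k; rewrite mxE isometric_basis.
have [w ->] := hs Wb v; congr (h b _).
by apply/colP => k; rewrite mxE isometric_basis.
Qed.

Lemma entry_continuous (m : nat) (k : 'I_m) (p : B * 'cV[Cplx R]_m) :
  {for p, continuous (fun q : B * 'cV[Cplx R]_m => q.2 k 0)}.
Proof.
have := (@continuous_mxP _ _ _ _ (fun q : B * 'cV[Cplx R]_m => q.2) p).1.
by move/(_ (@cvg_snd _ _ _ _ _)); apply.
Qed.

Lemma fst_continuous_comp (m : nat) (T : topologicalType) (f : B -> T)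
    (p : B * 'cV[Cplx R]_m) : {for p.1, continuous f} ->
  {for p, continuous (fun q : B * 'cV[Cplx R]_m => f q.1)}.
Proof.
by move=> fc; apply: (@continuous_comp _ _ _ fst f) => //; exact: cvg_fst.
Qed.

Lemma pair_continuous (m m' : nat) (g : B * 'cV[Cplx R]_m -> 'cV[Cplx R]_m')
    (p : B * 'cV[Cplx R]_m) : (forall k, {for p, continuous (fun q => g q k 0)}) ->
  {for p, continuous (fun q => (q.1, g q))}.
Proof.
move=> gc; have gc' : g q @[q --> p] --> g p.
  by apply/continuous_mxP => i j; rewrite [j]ord1; exact: gc.
exact: (@cvg_pair _ _ _ (nbhs p) (nbhs p.1) (nbhs (g p)) (nbhs_filter _)
  (nbhs_filter _) (nbhs_filter _) _ _ (@cvg_fst _ _ _ _ _) gc').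
Qed.

Lemma near_fst (m : nat) (O : set B) (p : B * 'cV[Cplx R]_m) : open O -> O p.1 ->
  \forall q \near p, O q.1.
Proof.
move=> Oo Op; have : nbhs p.1 O by apply: open_nbhs_nbhs.
exact: (@cvg_fst _ _ (nbhs p.1) (nbhs p.2) _).
Qed.

(** Both topological conditions are read in a local trivialization of [V], whose rank [m] is not
    compared with [n]. In it [h] is a combination of continuous frame sections. *)
Lemma isometric_trivialization : trivialization (pt V) W h.
Proof.
split=> //.
- by move=> b Wb; split; [exact: hl|exact: isometric_bijective].
- rewrite continuous_open_subspace; last exact: open_setX Wo openT.
  move=> p; rewrite inE => -[/= Wp _].
  have [m [W' [g [c [W'p gt cP _]]]]] := local_frame V p.1.
  have [W'o _ _ _] := gt.
  apply: (@continuous_near_eq _ _ (fun q : B * 'cV[Cplx R]_n =>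
      pt V (existT _ q.1 (g q.1 (c q.1 (h q.1 q.2)))))).
    by apply: filterS (near_fst W'o W'p) => q W'q; rewrite (cP _ W'q).2.
  apply: (@continuous_comp _ _ _ (fun q : B * 'cV[Cplx R]_n => (q.1, c q.1 (h q.1 q.2)))
    (fun q : B * 'cV[Cplx R]_m => pt V (existT _ q.1 (g q.1 q.2)))); last first.
    exact: (triv_continuous gt).
  apply: pair_continuous => j.
  apply: (@continuous_near_eq _ _ (fun q : B * 'cV[Cplx R]_n =>
      \sum_k q.2 k 0 * c q.1 (h q.1 (basis_vec R k)) j 0)).
    apply: filterS2 (near_fst W'o W'p) (near_fst Wo Wp) => q W'q Wq.
    rewrite {2}[q.2]cV_sum_basis (linear_sumZ _ _ _ (hl Wq)).
    rewrite (linear_sumZ _ _ _ (coord_linear gt cP W'q)) summxE.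
    by apply: eq_bigr => k _; rewrite mxE.
  apply: continuous_sum => k; apply: cvgM; first exact: entry_continuous.
  apply: (@fst_continuous_comp n _ (fun y => c y (h y (basis_vec R k)) j 0)).
  by have /(scont_coordP gt cP _ W'p)/continuous_mxP := @hc _ k Wp; apply.
- move=> O Oo OW; rewrite openE => _ [p Op <-]; rewrite /interior.
  have [Wp _] := OW _ Op.
  have [m [W' [g [c [W'p gt cP _]]]]] := local_frame V p.1.
  have [W'o _ _ go] := gt.
  (* Coordinates in an orthonormal frame are inner products with it, so the inverse of [h] is
     continuous without inverting a matrix. *)
  pose d (q : B * 'cV[Cplx R]_m) : 'cV[Cplx R]_n :=
    \col_k hip (h q.1 (basis_vec R k)) (g q.1 q.2).
  pose p0 : B * 'cV[Cplx R]_m := (p.1, c p.1 (h p.1 p.2)).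
  have dp0 : (p0.1, d p0) = p.
    rewrite [RHS]surjective_pairing; congr (_, _); apply/colP => k.
    by rewrite mxE /= (cP _ W'p).2 isometric_basis.
  have dc : {for p0, continuous (fun q => (q.1, d q))}.
    apply: pair_continuous => k.
    apply: (@continuous_near_eq _ _ (fun q : B * 'cV[Cplx R]_m =>
        \sum_j q.2 j 0 * hip (h q.1 (basis_vec R k)) (g q.1 (basis_vec R j)))).
      apply: filterS (near_fst (p := p0) W'o W'p) => q W'q.
      by rewrite mxE (triv_basis gt q.2 W'q) hip_sumr; apply: eq_bigr => j _; rewrite hipZr.
    apply: continuous_sum => j; apply: cvgM; first exact: entry_continuous.
    apply: (@fst_continuous_comp m _ (fun y => hip (h y (basis_vec R k)) (g y (basis_vec R j)))).
    by apply: hip_continuous; [exact: hc|exact: (scont_frame gt cP)].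
  have Np0 : nbhs p0 [set q | O (q.1, d q) /\ W' q.1].
    apply: filterI; last exact: (near_fst (p := p0) W'o W'p).
    by apply: dc; rewrite dp0; apply: open_nbhs_nbhs.
  move: Np0; rewrite (@nbhsE _ p0) => -[N [No Np0] NO].
  have := go N No; set G := _ @` _ => Go.
  apply: filterS (open_nbhs_nbhs (conj (Go _) _)).
  - move=> _ [q /NO[Oq W'q] <-]; exists (q.1, d q) => //=.
    have [Wq _] := OW _ Oq; congr (pt V (existT _ _ _)).
    have [a ga] := hs Wq (g q.1 q.2); rewrite ga; congr (h _ _).
    by apply/colP => k; rewrite mxE ga isometric_basis.
  - by move=> q /NO[].
  - by exists p0 => //=; rewrite (cP _ W'p).2.
Qed.

End FrameTrivialization.

Lemma unitary_monomial_inj (R : realType) (m n : nat) (d : 'I_m -> Cplx R)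
    (rho : 'I_m -> 'I_n) : m = n -> injective rho -> (forall k, `|d k| = 1) ->
  unitary_monomial (\matrix_(k, l) (if l == rho k then d k else 0)).
Proof.
move=> e; case: n / e rho => rho rhoI d1.
exists erefl, (\row_k d k), (perm rhoI); split; first by move=> k; rewrite mxE.
rewrite castmx_id; apply/matrixP => k l.
by rewrite mul_diag_mx !mxE permE eq_sym; case: eqP; rewrite ?mulr1 ?mulr0.
Qed.

(** * The atlas of a twisted correspondence *)

Section AtlasOfTwistedCorrespondence.
Variables (R : realType) (X Y : topologicalType).
Hypotheses (hX : hausdorff_space X) (lcX : locally_compact [set: X]).
Variables (E : correspondence R Y X) (U : set X).
Hypothesis openU : open U.
Variables (V : herm_bundle R U) (Phi : E -> bundle_section V).
Hypothesis isoPhi : Gamma0_iso set_val Phi.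
Variables (Z : twisted_correspondence R Y X) (Psi : E -> bundle_section (tc_line Z)).
Hypothesis isoPsi : tc_iso Psi.
Variable peak : tc_space Z -> E.
Hypothesis peakP : forall z, [/\ slice_supported (tc_s Z) Psi (peak z),
  fibnorm (Psi (peak z) z) = 1 & hmnorm (peak z) = 1].

Let iso := isoPsi.1.
Let sl := tc_s_local_homeo Z.
Let sp := tc_s_proper (t := Z).
Let hZ := tc_hausdorff (t := Z).
Let lcZ := tc_locally_compact (t := Z).
Let Ll := tc_line_bundle (t := Z).
Notation s := (tc_s Z).

(** Both sides say that [ptnorm (u - v)] vanishes at [b]. This is the identification of V_b with the
    sum of the lines L_z over [b], without writing the map. *)
Lemma iso_fibreP u v (b : U) :
  Phi u b = Phi v b <-> forall z, s z = set_val b -> Psi u z = Psi v z.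
Proof.
have vE : ptnorm (u - v) (set_val b) = 0 <-> Phi u b = Phi v b.
  have c : concentrated (set_val : U -> X) Phi (u - v) b by move=> b' /val_inj.
  have uvE : hip (Phi (u - v) b) (Phi (u - v) b) = (ptnorm (u - v) (set_val b) ^+ 2)%:C%C.
    by rewrite -(inner_concentrated isoPhi _ c) inner_ptnorm.
  split=> [uv0|uv].
    by apply/eqP; rewrite -subr_eq0 -(isoB isoPhi) -hip_eq0 uvE uv0 expr0n.
  apply/eqP; rewrite -sqrf_eq0; apply/eqP/(@complexI R).
  by rewrite -uvE (isoB isoPhi) uv subrr hip0l.
rewrite -vE (ptnorm_eq0P iso Ll peakP); split=> H z zb.
  by apply/eqP; rewrite -subr_eq0 -(isoB iso) H.
by rewrite (isoB iso) H// subrr.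
Qed.

(** Computed through [Phi], inner products vanish outside [U], whereas the peak at [z] is not null
    over [s z]. *)
Lemma range_in_base z : exists b : U, set_val b = s z.
Proof.
apply: contrapT => nb; have /eqP := peak_neq0 peakP z; apply.
apply: (ptnorm_eq0P iso Ll peakP (peak z) (s z)).1 => //.
apply/eqP; rewrite -sqrf_eq0 -cabs_inner (inner_vanish isoPhi) ?cabs0// => b bz.
by exfalso; apply: nb; exists b.
Qed.

Lemma fibre_value_exists (b : U) (v : fib V b) : exists u, Phi u b = v.
Proof.
have [n [W [h [c [Wb ht cP _]]]]] := local_frame V b.
have [Wo _ _ _] := ht.
have [|rho [_ _ r1 /(giso_surj isoPhi)[u uE]]] := @cutoff_section _ _ V
  (open_locally_compact openU hX lcX) (open_hausdorff_subspace hX) b W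
  (fun y => h y (c b v)) Wo Wb.
  by move=> y Wy; exact: (scont_frame ht cP).
by exists u; rewrite uE (nbhs_singleton r1) scale1r (cP b Wb).2.
Qed.

(** * Properties of any atlas built from a twisted correspondence *)

Section Constructed.
Variables (A : atlas V)
  (slice : forall i : chart_index A, 'I_(chart_rank A i) -> set (tc_space Z))
  (t : forall i : chart_index A, 'I_(chart_rank A i) -> bundle_section (tc_line Z)).
Hypothesis ca : constructed_atlas Phi Psi slice t.

Lemma slice_point i b k : chart_dom A i b -> exists2 z, slice (i := i) k z & s z = set_val b.
Proof.
move=> ib; have [_ _ surj] := ca_slice_bij ca k (i := i).
by have [|z kz zb] := surj (set_val b); [exists b|exists z].
Qed.

Lemma slice_eq i k z z' : slice (i := i) k z -> slice k z' -> s z = s z' -> z = z'.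
Proof.
by move=> kz kz'; have [_ inj _] := ca_slice_bij ca k; apply: inj; rewrite inE.
Qed.

Lemma slice_cover i b z : chart_dom A i b -> s z = set_val b -> exists k, slice (i := i) k z.
Proof.
move=> ib zb; have : (s @^-1` (set_val @` chart_dom A i)) z by exists b.
by rewrite (ca_preimage ca) => -[k _ kz]; exists k.
Qed.

Lemma chart_vector i b k z : chart_dom A i b -> slice (i := i) k z -> s z = set_val b ->
  exists u, [/\ Phi u b = chart A i b (basis_vec R k), Psi u z = t k z &
    concentrated s Psi u z].
Proof.
move=> ib kz zb; have [u [ub uz u0]] := ca_chart ca ib kz zb.
by exists u; split=> // z' z'z; apply: u0; rewrite z'z.
Qed.

Lemma slice_fibnorm i k z : slice (i := i) k z -> fibnorm (t k z) = 1.
Proof.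
move=> /(ca_unit ca); rewrite hip_fibnorm => /(@complexI _ _ 1)/eqP.
by rewrite sqrp_eq1 ?fibnorm_ge0// => /eqP.
Qed.

Lemma chart_orthonormal i b (ib : chart_dom A i b) k l :
  hip (chart A i b (basis_vec R k)) (chart A i b (basis_vec R l)) = (k == l)%:R.
Proof.
have [z kz zb] := slice_point k ib; have [z' lz' zb'] := slice_point l ib.
have [u [<- uz uc]] := chart_vector ib kz zb.
have [v [<- vz vc]] := chart_vector ib lz' zb'.
have ub : concentrated (set_val : U -> X) Phi u b by move=> b' /val_inj.
rewrite -(inner_concentrated isoPhi _ ub) -zb (inner_concentrated iso _ uc) uz.
have [kl|kl] := eqVneq k l.
  subst l; have zz' : z = z' by apply: (slice_eq kz lz'); rewrite zb zb'.
  by subst z'; rewrite vz (ca_unit ca).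
rewrite vc ?hip0r ?zb ?zb'// => zz'; subst z'.
by move: kl; rewrite (ca_slice_disj ca kz lz') eqxx.
Qed.

Lemma chart_sum i b v : chart_dom A i b ->
  chart A i b v = \sum_k v k 0 *: chart A i b (basis_vec R k).
Proof. by move=> ib; rewrite {1}[v]cV_sum_basis (linear_sumZ _ _ _ (ca_linear ca ib)). Qed.

Lemma chart_isometric i b v w : chart_dom A i b ->
  hip (chart A i b v) (chart A i b w) = \sum_k (v k 0)^* * w k 0.
Proof.
move=> ib; rewrite (chart_sum v ib) (chart_sum w ib) hip_suml; apply: eq_bigr => k _.
rewrite hip_sumr (bigD1 k)//= big1 ?addr0 => [|l lk].
  by rewrite hipZl hipZr chart_orthonormal// eqxx mulr1.
by rewrite hipZl hipZr chart_orthonormal// eq_sym (negbTE lk) !mulr0.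
Qed.

(** Each point over [b] lies on exactly one sheet; the coordinates of a vector are its components
    there, measured against the unit vectors [t k]. *)
Lemma chart_surj i b : chart_dom A i b -> forall v, exists a, v = chart A i b a.
Proof.
move=> ib v; have [w <-] := fibre_value_exists v.
have /choice[z zP] : forall k, exists z, slice (i := i) k z /\ s z = set_val b.
  by move=> k; have [z kz zb] := slice_point k ib; exists z.
have /choice[u uP] : forall k, exists u, [/\ Phi u b = chart A i b (basis_vec R k),
    Psi u (z k) = t k (z k) & concentrated s Psi u (z k)].
  by move=> k; have [kz zb] := zP k; exact: chart_vector.
pose c k := hip (t k (z k)) (Psi w (z k)).
exists (\col_k c k); rewrite chart_sum//.
transitivity (Phi (\sum_k c k *: u k) b); last first.
  rewrite (iso_sum isoPhi); apply: eq_bigr => k _.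
  by rewrite (isoZ isoPhi) mxE; have [-> _ _] := uP k.
apply/iso_fibreP => y yb; have [k ky] := slice_cover ib yb.
have [kz zb] := zP k; have -> : y = z k by apply: (slice_eq ky kz); rewrite yb zb.
rewrite (iso_sum iso) (bigD1 k)//= big1 ?addr0 => [|l lk].
  rewrite (isoZ iso); have [_ -> _] := uP k.
  by rewrite -(fib_unit Ll)//; exact: slice_fibnorm.
rewrite (isoZ iso); have [_ _ ->] := uP l; rewrite ?scaler0//.
  by have [_ ->] := zP l.
move=> zkl; have [lz _] := zP l; move: lk.
by rewrite -zkl in lz; rewrite (ca_slice_disj ca kz lz) eqxx.
Qed.

(** The frame vector at each base point is witnessed by its own element of [E], with no link between
    points. Cutting off [t k] inside its sheet gives one element [u] whose image under [Phi] is the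
    frame vector at all nearby points. *)
Lemma chart_scont i b k : chart_dom A i b ->
  scont_at (fun y => chart A i y (basis_vec R k)) b.
Proof.
move=> ib; have [z0 kz0 zb0] := slice_point k ib.
have So := ca_slice_open ca k (i := i).
have tc z : slice (i := i) k z -> scont_at (t k) z.
  have H : continuous_section (slice (i := i) k) (t k) by exact: (ca_continuous ca).
  exact: (continuous_sectionP (t k) So).1 H z.
have [u [rho [_ r0 r1 uE]]] := cutoff_element iso lcZ hZ So kz0 tc.
refine (scont_near _ (@iso_scont _ _ _ _ _ _ _ isoPhi u b)).
have {}r1 : nbhs z0 [set z | rho z = 1] := r1.
move: r1; rewrite (@nbhsE _ z0) => -[N [No Nz0] Nr].
have : nbhs b (chart_dom A i `&` set_val @^-1` (s @` (N `&` slice (i := i) k))).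
  apply: filterI; first by apply: open_nbhs_nbhs; split=> //; exact: (ca_open ca).
  apply: set_val_continuous; apply: open_nbhs_nbhs; split.
    by apply: local_homeomorphism_open => //; exact: openI.
  by exists z0.
apply: filterS => y [iy [z [Nz kz] zy]].
have [v [<- vz vc]] := chart_vector iy kz zy.
apply/iso_fibreP => z' z'y; have [->|zz'] := pselect (z' = z).
  by rewrite uE vz (Nr _ Nz) scale1r.
rewrite vc ?zy// uE; have [kz'|/r0 ->] := pselect (slice k z'); last by rewrite scale0r.
by exfalso; apply: zz'; apply: (slice_eq kz' kz); rewrite z'y zy.
Qed.

Lemma constructed_is_atlas : is_atlas A.
Proof.
split; first exact: (ca_cover ca).
- move=> i; apply: isometric_trivialization.
  + exact: (ca_open ca).
  + by move=> b; exact: (ca_linear ca).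
  + exact: chart_surj.
  + by move=> b ib v w; exact: chart_isometric.
  + by move=> b k; exact: chart_scont.
- by move=> i b v w; exact: chart_isometric.
Qed.

(** Over [b] both frames consist of unit vectors of the same lines L_z: sheets through a common [z]
    are matched, and the two unit vectors at [z] differ by a phase. *)
Lemma transition_injection i j b : chart_dom A i b -> chart_dom A j b ->
  exists (rho : 'I_(chart_rank A i) -> 'I_(chart_rank A j)) (d : 'I_(chart_rank A i) -> Cplx R),
    [/\ injective rho, forall k, `|d k| = 1 &
      forall k, chart A j b (basis_vec R (rho k)) = d k *: chart A i b (basis_vec R k)].
Proof.
move=> ib jb.
have /choice[z zP] : forall k, exists z, slice (i := i) k z /\ s z = set_val b.
  by move=> k; have [z kz zb] := slice_point k ib; exists z.
have /choice[rho rP] : forall k, exists l, slice (i := j) l (z k).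
  by move=> k; apply: (slice_cover jb); have [] := zP k.
exists rho, (fun k => hip (t k (z k)) (t (rho k) (z k))); split.
- move=> k k' kk'; have [kz zb] := zP k; have [kz' zb'] := zP k'.
  have zz' : z k = z k'.
    have lz := rP k; have lz' := rP k'; rewrite -kk' in lz'.
    by apply: (slice_eq lz lz'); rewrite zb zb'.
  by apply: (ca_slice_disj ca kz); rewrite zz'.
- move=> k; have [kz zb] := zP k.
  have := slice_fibnorm (rP k).
  rewrite {1}(fib_unit Ll (t (rho k) (z k)) (slice_fibnorm kz)) fibnormZ (slice_fibnorm kz) mulr1.
  by rewrite normC_cabs => ->.
- move=> k; have [kz zb] := zP k.
  have [u [<- uz uc]] := chart_vector ib kz zb.
  have [v [<- vz vc]] := chart_vector jb (rP k) zb.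
  rewrite -(isoZ isoPhi); apply/iso_fibreP => y yb.
  rewrite (isoZ iso); have [->|yz] := pselect (y = z k).
    by rewrite uz vz -(fib_unit Ll)//; exact: slice_fibnorm.
  by rewrite uc ?vc ?scaler0 ?zb ?yb.
Qed.

Lemma constructed_normalizing : normalizing_atlas A.
Proof.
move=> i j b ib jb.
have [rho [d [rI d1 dE]]] := transition_injection ib jb.
have [rho' [_ [rI' _ _]]] := transition_injection jb ib.
have ij : chart_rank A i = chart_rank A j.
  have := leq_card rho rI; have := leq_card rho' rI'; rewrite !card_ord => h1 h2.
  by apply/eqP; rewrite eqn_leq h1 h2.
have rB : bijective rho by apply: inj_card_bij => //; rewrite !card_ord ij.
exists (\matrix_(k, l) (if l == rho k then d k else 0)); split; last exact: unitary_monomial_inj.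
move=> v; rewrite (chart_sum v jb) (chart_sum _ ib) (reindex rho)/=; last exact: onW_bij.
apply: eq_bigr => k _; rewrite dE scalerA; congr (_ *: _).
rewrite mxE (bigD1 (rho k))//= big1 ?addr0 => [|l lk]; first by rewrite mxE eqxx mulrC.
by rewrite mxE (negbTE lk) mul0r.
Qed.

(** T_b is defined by lifting vectors of V_b to [E], which is unambiguous as [T] acts fibrewise. Its
    eigenvalue on the k-th frame vector is [f] at the point of the k-th sheet over [b]. *)
Lemma mult_diagonal_at f T i b : C0 f -> mult Psi f T -> chart_dom A i b ->
  diagonal_at Phi T i b.
Proof.
move=> fC fT ib; have [aT _] := mult_compact iso sl sp Ll peakP fC fT.
have /choice[g gP] : forall v : fib V b, exists u, Phi u b = v by exact: fibre_value_exists.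
have Tb u v : Phi u b = Phi v b -> Phi (T u) b = Phi (T v) b.
  move=> /iso_fibreP uv; apply/iso_fibreP => z zb.
  by apply: (adjointable_fibrewise iso Ll peakP aT) => z' z'z; apply: uv; rewrite z'z.
exists (fun v => Phi (T (g v)) b); split=> [u|k]; first by apply: Tb; rewrite gP.
have [z kz zb] := slice_point k ib; have [u [<- uz uc]] := chart_vector ib kz zb.
exists (f z); rewrite (Tb _ u) ?gP// -(isoZ isoPhi); apply/iso_fibreP => y yb.
rewrite fT (isoZ iso); have [->//|yz] := pselect (y = z).
by rewrite uc ?scaler0// yb zb.
Qed.

(** For the inclusion from left to right, a vector concentrated at [z] agrees over [s z] with a
    multiple of the frame vector through [z]. Being an eigenvector there, it stays concentrated
    under [T], and [compact_diagonal] applies. *)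
Lemma cartan_of_constructed_atlas : cartan_of_atlas Phi A = mult_algebra Psi.
Proof.
apply/seteqP; split=> T; last first.
  move=> TD; split; first exact: (mult_algebra_compact iso sl sp Ll peakP TD).
  by have [f fC fT] := TD => i b ib; exact: mult_diagonal_at fC fT ib.
move=> [TK Td]; exists (diag_coef s peak T); first exact: (diag_coef_C0 iso Ll peakP TK).
apply: (compact_diagonal iso Ll peakP TK) => z u uc z' z'z zz'.
have [b bz] := range_in_base z; have [i ib] := ca_cover ca b.
have [k kz] := slice_cover ib (esym bz).
have [v [vb vz vc]] := chart_vector ib kz (esym bz).
have [Tb [TbE /(_ k)[a]]] := Td i b ib; rewrite -vb -TbE -(isoZ isoPhi) => /iso_fibreP Tv.
have [aT _] := TK; pose c := hip (t k z) (Psi u z).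
have uv y : s y = s z' -> Psi u y = Psi (c *: v) y.
  rewrite z'z (isoZ iso) => yz; have [->|nyz] := pselect (y = z).
    by rewrite vz -(fib_unit Ll)//; exact: slice_fibnorm kz.
  by rewrite uc// vc// scaler0.
rewrite (adjointable_fibrewise iso Ll peakP aT uv).
rewrite (adjointableZ _ _ aT) (isoZ iso) Tv ?bz//.
by rewrite (isoZ iso) vc// !scaler0.
Qed.

Hypothesis lactD : contains_left_action (mult_algebra Psi).

Lemma constructed_diagonalizing : diagonalizing_atlas Phi A.
Proof.
split; first exact: (ca_precompact ca).
by move=> g i b /lactD[f fC fT] ib; exact: mult_diagonal_at fC fT ib.
Qed.

End Constructed.

(** [g] acts as multiplication by its pullback along [r], which vanishes at infinity because [r] is
    proper. *)
Lemma left_action_mult : contains_left_action (mult_algebra Psi).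
Proof.
move=> g gC; exists (fun z => g (tc_r Z z)); last by move=> u z; exact: isoPsi.2.
have [rc rp] := tc_r_proper Z; have [gc gv] := gC; split=> [z|e /gv/rp//].
by apply: (@continuous_comp _ _ _ (tc_r Z) g); [exact: rc|exact: gc].
Qed.

(* The sheets of s over an evenly covered neighbourhood, with a unit section of
   the line bundle on each of them. *)
Definition local_sheets : Type :=
  {n : nat & (set U * ('I_n -> set (tc_space Z)) * ('I_n -> bundle_section (tc_line Z)))%type}.

Definition sheets_at (b : U) (D : local_sheets) : Prop :=
  let N := (tagged D).1.1 in let S := (tagged D).1.2 in let t := (tagged D).2 in
  [/\ [/\ N b, open N & compact (closure N)],
      [/\ forall k, open (S k),
          forall k, set_bij (S k) (set_val @` N) s,
          forall k k' z, S k z -> S k' z -> k = k' &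
          s @^-1` (set_val @` N) = \bigcup_k S k] &
      forall k z, S k z -> scont_at (t k) z /\ fibnorm (t k z) = 1].

Lemma closure_compact (N : set U) (K : set X) : compact K -> K `<=` U ->
  N `<=` set_val @^-1` K -> compact (closure N).
Proof.
move=> Kc KU NK; have Kc' : compact (set_val @^-1` K : set U) by exact: compact_set_val.
apply: (subclosed_compact (@closed_closure _ N) Kc').
have /closure_id -> := compact_closed (open_hausdorff_subspace hX) Kc'.
exact: closureS.
Qed.

(* V vanishes at b, hence near b as its rank is locally constant, so that no
   point of Z lies over a neighbourhood of b. *)
Lemma sheets_empty_fibre (b : U) : (forall z, s z <> set_val b) ->
  exists D, sheets_at b D.
Proof.
move=> nb; have [n [W [h [c [Wb ht cP _]]]]] := local_frame V b.
have [Wo hW _ _] := ht.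
have n0 : n = 0%N.
  case: n => // n in W h c Wb ht cP Wo hW *.
  (* In positive rank a basis vector of V_b would be the value of an element of [E] that agrees with
     0 at [b], no point of Z lying over [b]. *)
  have [u ub] := fibre_value_exists (h b (basis_vec R (ord0 : 'I_n.+1))).
  have u0 : Phi u b = Phi 0 b by apply/iso_fibreP => z /nb.
  have := congr1 (fun v => c b v ord0 ord0) (etrans (esym ub) u0).
  rewrite (cP b Wb).1 (iso0 isoPhi) !mxE eqxx /=.
  have := coord_linear ht cP Wb (-1) 0 0; rewrite scaler0 addr0 scaleN1r addNr => ->.
  by rewrite mxE => /eqP; rewrite oner_eq0.
subst n.
have nW (y : U) z : W y -> s z <> set_val y.
  move=> Wy zy; have /eqP := peak_neq0 peakP z; apply.
  rewrite -(iso0 iso z).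
  have /iso_fibreP : Phi (peak z) y = Phi 0 y; last by apply.
  rewrite -[LHS](cP y Wy).2 -[RHS](cP y Wy).2; congr (h y _).
  by apply/colP => -[].
have [K [Kc KW Kb]] := compact_nbhs_in lcX hX (nbhs_set_val openU (open_nbhs_nbhs (conj Wo Wb))).
pose N : set U := set_val @^-1` K^°.
have NW y : N y -> W y.
  by move=> /interior_subset/KW[a Wa /val_inj <-].
exists (existT _ 0%N ((N, fun k : 'I_0 => set0), fun k : 'I_0 => fun z => 0)).
split=> /=; last by case.
- split=> //.
    by move/continuousP : (@set_val_continuous X U); apply; exact: open_interior.
  apply: (closure_compact Kc) => [x /KW[a _ <-]|y /interior_subset//].
  exact: set_val_in.
- split; [by case|by case|by case|].
  apply/seteqP; split=> [z [y Ny yz]|z [[]//]].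
  by have := nW y z (NW y Ny); rewrite yz.
Qed.

(** The separating sets are chosen for ordered pairs, so those for [(k, l)] and [(l, k)] are
    unrelated; each [G k] is therefore cut down by both. *)
Lemma hausdorff_sheets (T : topologicalType) (n : nat) (q : 'I_n -> T) :
  hausdorff_space T -> injective q -> exists G : 'I_n -> set T,
    (forall k, nbhs (q k) (G k)) /\ forall k l z, G k z -> G l z -> k = l.
Proof.
rewrite open_hausdorff => hT qI.
have sepP : forall p : T * T, exists AB : set T * set T, p.1 != p.2 ->
    [/\ nbhs p.1 AB.1, nbhs p.2 AB.2 & AB.1 `&` AB.2 = set0].
  move=> [x y]; have [->|xy] := eqVneq x y; first by exists (set0, set0).
  have [AB [xA yB] [Ao Bo AB0]] := hT _ _ xy; exists AB => _; split.
  - by apply: open_nbhs_nbhs; split=> //; rewrite -inE.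
  - by apply: open_nbhs_nbhs; split=> //; rewrite -inE.
  - exact/eqP.
have [sep sepE] := choice sepP.
pose G k := [set z | forall l, l != k -> (sep (q k, q l)).1 z /\ (sep (q l, q k)).2 z].
exists G; split=> [k|k l z Gk Gl].
  apply: filter_forall => l; have [->|lk] := eqVneq l k.
    by apply: nearW => z.
  have qkl : q k != q l by apply: contra lk => /eqP/qI ->.
  have [Ak _ _] := sepE (q k, q l) qkl.
  have [_ Bk _] := sepE (q l, q k) (contra_neq esym qkl).
  by apply: filterS2 Ak Bk => z a b _.
apply/eqP; apply: contrapT => /negP kl.
have [a _] := Gk l (contra_neq esym kl); have [_ b] := Gl k kl.
have qkl : q k != q l by apply: contra kl => /eqP/qI ->.
have [_ _ AB0] := sepE (q k, q l) qkl.
by suff : set0 z by []; rewrite -AB0.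
Qed.

(* Disjoint sheets around the finitely many points over b need not exhaust
   s^-1(N); properness removes from N the compact image of the complement. *)
Lemma sheets_nonempty_fibre (b : U) z0 : s z0 = set_val b -> exists D, sheets_at b D.
Proof.
move=> z0b; pose x := set_val b : X; have [sc si] := sl.
have := fibre_finite sl sp x; move/finite_seqP => [r0 r0E].
pose r := undup r0; have rP z : (z \in r) = (s z == x).
  rewrite mem_undup; apply/idP/eqP => [zr|zx].
    by have : [set` r0] z by []; rewrite -r0E.
  by have : (s @^-1` [set x]) z by []; rewrite r0E.
pose n := size r; pose q (k : 'I_n) := nth z0 r k.
have qI : injective q.
  by move=> k l /eqP; rewrite nth_uniq ?undup_uniq// => /eqP/val_inj.
have qx k : s (q k) = x by apply/eqP; rewrite -rP mem_nth.
have qsurj z : s z = x -> exists k, z = q k.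
  move=> /eqP; rewrite -rP => zr.
  have zi : (index z r < n)%N by rewrite index_mem.
  by exists (Ordinal zi); rewrite /q /= nth_index.
have [G [Gq Gd]] := hausdorff_sheets hZ qI.
have /choice[W WP] : forall k, exists W : set (tc_space Z) * bundle_section (tc_line Z),
    [/\ open W.1, W.1 (q k), W.1 `<=` G k, set_inj W.1 s &
    forall z, W.1 z -> scont_at W.2 z /\ fibnorm (W.2 z) = 1].
  move=> k; have [N [t [No Nq Nt]]] := local_unit_section (q k) Ll.
  have [I [Io Iq Ii _]] := si (q k).
  exists ((G k)^° `&` N `&` I, t); split=> /=.
  - by apply: openI => //; apply: openI => //; exact: open_interior.
  - by split=> //; split=> //; exact: Gq.
  - by move=> z [[/interior_subset]].
  - by move=> z z'; rewrite !inE => -[_ Iz] [_ Iz']; apply: Ii; rewrite inE.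
  - by move=> z [[_ /Nt]].
pose Wu := \bigcup_k (W k).1.
have Wuo : open Wu by apply: bigcup_open => k _; have [] := WP k.
have so : open (s @` setT) by exact: local_homeomorphism_open sl openT.
have sx : (s @` setT) x by exists z0.
(* [K] is taken inside the image of [s], where properness makes its preimage compact. *)
have [K [Kc Ks Kx]] := compact_nbhs_in lcX hX (open_nbhs_nbhs (conj so sx)).
have sKc : compact (s @^-1` K) by apply: sp => // y /Ks.
pose C := s @^-1` K `&` ~` Wu.
have Cc : compact C.
  apply: (subclosed_compact _ sKc); last by move=> z [].
  by apply: closedI; [exact: compact_closed|exact: open_closedC].
have sCc : closed (s @` C).
  by apply: compact_closed => //; apply: continuous_compact => //; exact: continuous_subspaceT.
have nCx : ~ (s @` C) x.
  move=> [z [_ nW] zx]; apply: nW; have [k ->] := qsurj z zx.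
  by exists k => //; have [] := WP k.
(* The three conditions give, in order, compact closure, a point of every sheet over each [y], and
   no point over [y] outside the sheets. *)
pose M := [set y | [/\ K y, forall k, (s @` (W k).1) y & ~ (s @` C) y]]^°.
have Mx : M x.
  suff : nbhs x ([set y | K y] `&` [set y | forall k, (s @` (W k).1) y] `&` ~` (s @` C)).
    by apply: filterS => y [[]].
  apply: filterI; first apply: filterI => //.
    apply: filter_forall => k; have [Wo Wq _ _ _] := WP k.
    by apply: open_nbhs_nbhs; split; [exact: local_homeomorphism_open|exists (q k)].
  by apply: open_nbhs_nbhs; split=> //; exact: closed_openC.
have MP y : M y -> [/\ K y, forall k, (s @` (W k).1) y & ~ (s @` C) y] by move/interior_subset.
have KU : K `<=` U.
  by move=> y /Ks[z _ <-]; have [b' <-] := range_in_base z; exact: set_val_in.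
pose N : set U := set_val @^-1` M.
have NM : set_val @` N = M.
  apply/seteqP; split=> [_ [a Na <-]//|y My].
  have [/KU Uy _ _] := MP y My; have [a ay] := set_val_exists Uy.
  by exists a => //; rewrite /N /= ay.
pose S k := (W k).1 `&` s @^-1` M.
exists (existT _ n ((N, S), fun k => (W k).2)); split=> /=.
- split=> //.
    by move/continuousP : (@set_val_continuous X U); apply; exact: open_interior.
  by apply: (closure_compact Kc KU) => y /MP[].
- rewrite NM; split.
  + move=> k; apply: openI; first by have [] := WP k.
    by move/continuousP : sc; apply; exact: open_interior.
  + move=> k; have [_ _ _ Wi _] := WP k; split.
    * by move=> z [].
    * by move=> z z'; rewrite !inE => -[Wz _] [Wz' _]; apply: Wi; rewrite inE.
    * by move=> y /[dup] My /MP[_ /(_ k)[z Wz zy] _]; exists z => //; split=> //; rewrite /= zy.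
  + by move=> k l z [kz _] [lz _]; apply: (Gd k l z);
      [have [_ _ + _ _] := WP k|have [_ _ + _ _] := WP l]; apply.
  + apply/seteqP; split=> [z Mz|z [k _ []]//].
    have [Kz _ nC] := MP _ Mz.
    have [k _ Wz] : Wu z by apply: contrapT => nW; apply: nC; exists z.
    by exists k.
- by move=> k z [Wz _]; have [_ _ _ _] := WP k; apply.
Qed.

Lemma constructed_atlas_exists : exists (A : atlas V)
    (slice : forall i : chart_index A, 'I_(chart_rank A i) -> set (tc_space Z))
    (t : forall i : chart_index A, 'I_(chart_rank A i) -> bundle_section (tc_line Z)),
  constructed_atlas Phi Psi slice t.
Proof.
have /choice[D DP] : forall b : U, exists D, sheets_at b D.
  move=> b; have [[z zb]|nz] := pselect (exists z, s z = set_val b).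
    exact: sheets_nonempty_fibre zb.
  by apply: sheets_empty_fibre => z zb; apply: nz; exists z.
pose dom i := (tagged (D i)).1.1.
pose slice i := (tagged (D i)).1.2; pose t i := (tagged (D i)).2.
have wP i (b : U) k : exists w : fib V b, dom i b -> forall z, slice i k z ->
    s z = set_val b -> corresponds Phi Psi w (t i k z).
  have [[_ _ _] [_ Sb _ _] _] := DP i.
  have [ib|nib] := pselect (dom i b); last by exists 0.
  have [_ inj surj] := Sb k.
  have [|z kz zb] := surj (set_val b); first by exists b.
  (* The multiple of the peak whose component at [z] is [t i k z]; its other components over [b] are
     zero. *)
  pose u := hip (Psi (peak z) z) (t i k z) *: peak z.
  exists (Phi u b) => _ z' kz' zb'.
  have -> : z' = z by apply: inj; rewrite ?inE// zb zb'.
  exists u; split=> //.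
    by rewrite (isoZ iso) -(fib_peak Ll peakP).
  move=> y yb yz.
  by rewrite (isoZ iso) (peak_concentrated peakP (etrans yb (esym zb)) yz) scaler0.
pose w i b k := projT1 (cid (wP i b k)).
(* The charts are indexed by the base points themselves, one around each. *)
exists (@Atlas R U V U dom (fun i => tag (D i)) (fun i b v => \sum_k v k 0 *: w i b k)).
exists slice, t; split=> //=.
- by move=> b; exists b; have [[]] := DP b.
- by move=> i; have [[]] := DP i.
- by move=> i; have [[]] := DP i.
- by move=> i k; have [_ [So _ _ _] _] := DP i; exact: So.
- by move=> i k; have [_ [_ Sb _ _] _] := DP i; exact: Sb.
- by move=> i k k' z; have [_ [_ _ Sd _] _] := DP i; exact: Sd.
- by move=> i; have [_ [_ _ _ Sp] _] := DP i.
- move=> i k; have [_ [So _ _ _] St] := DP i.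
  by apply: (continuous_sectionP (t i k) (So k)).2 => z /St[].
- move=> i k z; have [_ _ St] := DP i => /St[_ tz].
  by rewrite hip_fibnorm tz expr1n.
- move=> i b _ a u v; rewrite scaler_sumr -big_split; apply: eq_bigr => k _ /=.
  by rewrite !mxE scalerDl scalerA.
- move=> i b k z ib kz zb; rewrite (bigD1 k)//= big1 ?addr0 => [|l lk].
    rewrite !mxE !eqxx scale1r /w; case: (cid _) => /= v; exact.
  by rewrite !mxE (negbTE lk) scale0r.
Qed.

End AtlasOfTwistedCorrespondence.

(** The two algebras in the last assertion may come from different isomorphisms [Psi], whence
    conjugacy rather than equality; the existence of an atlas keeps that assertion from being
    vacuous. *)
Theorem proposition4p13 (R : realType) (X Y : topologicalType)
    (hX : hausdorff_space X) (lcX : locally_compact [set: X])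
    (hY : hausdorff_space Y) (lcY : locally_compact [set: Y])
    (E : correspondence R Y X)
    (properE : proper_corr E) (nondegE : nondegenerate_corr E)
    (U : set X) (openU : open U) (V : herm_bundle R U)
    (Phi : E -> bundle_section V) (isoPhi : Gamma0_iso set_val Phi)
    (Z : twisted_correspondence R Y X) (assocZ : associated E Z) :
  [/\ (exists A : atlas V, atlas_of_tc Phi Z A),
      (forall A : atlas V, atlas_of_tc Phi Z A ->
         normalizing_diagonalizing_atlas Phi A),
      (forall D : set (E -> E),
         cartan_of_tc Z D \/
         (exists2 A : atlas V, atlas_of_tc Phi Z A & D = cartan_of_atlas Phi A) ->
         Cartan_subalgebra (compact_op (E := E)) D /\ contains_left_action D) &
      (forall (D : set (E -> E)) (A : atlas V),
         cartan_of_tc Z D -> atlas_of_tc Phi Z A ->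
         conjugate_subalgebras D (cartan_of_atlas Phi A))].
Proof.
have peaks (Psi : E -> bundle_section (tc_line Z)) : tc_iso Psi ->
    exists peak : tc_space Z -> E, forall z, [/\ slice_supported (tc_s Z) Psi (peak z),
      fibnorm (Psi (peak z) z) = 1 & hmnorm (peak z) = 1].
  move=> [iso _]; exact: (exists_peaks iso (tc_s_local_homeo Z)
    (tc_locally_compact (t := Z)) (tc_hausdorff (t := Z)) (tc_line_bundle (t := Z))).
have atlas_mult A : atlas_of_tc Phi Z A -> exists Psi : E -> bundle_section (tc_line Z),
    [/\ tc_iso Psi, cartan_of_atlas Phi A = mult_algebra Psi &
     normalizing_diagonalizing_atlas Phi A].
  move=> [Psi [slice [t [isoPsi ca]]]]; have [peak peakP] := peaks _ isoPsi.
  exists Psi; split=> //.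
    exact: (cartan_of_constructed_atlas hX lcX openU isoPhi isoPsi peakP ca).
  split; first exact: (constructed_is_atlas hX lcX openU isoPhi isoPsi peakP ca).
    exact: (constructed_normalizing isoPhi isoPsi peakP ca).
  apply: (constructed_diagonalizing hX lcX openU isoPhi isoPsi peakP ca).
  exact: left_action_mult.
have Cartan (Psi : E -> bundle_section (tc_line Z)) : tc_iso Psi ->
    Cartan_subalgebra (compact_op (E := E)) (mult_algebra Psi) /\
    contains_left_action (mult_algebra Psi).
  move=> isoPsi; have [peak peakP] := peaks _ isoPsi; split; last exact: left_action_mult.
  exact: (mult_algebra_Cartan isoPsi.1 (tc_s_local_homeo Z) (tc_s_proper (t := Z))
    (tc_locally_compact (t := Z)) (tc_hausdorff (t := Z)) (tc_line_bundle (t := Z)) peakP).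
split.
- have [Psi isoPsi] := assocZ; have [peak peakP] := peaks _ isoPsi.
  have [A [slice [t ca]]] := constructed_atlas_exists hX lcX openU isoPhi isoPsi peakP.
  by exists A, Psi, slice, t.
- by move=> A /atlas_mult[Psi []].
- move=> D [[Psi isoPsi ->]|[A /atlas_mult[Psi [isoPsi -> _]] ->]]; exact: Cartan.
- move=> D A [Psi [iso lact1] ->] /atlas_mult[Psi' [[iso' lact2] -> _]].
  have /choice[W WE] : forall u, exists v, Psi' v = Psi u.
    by move=> u; exact: (giso_surj iso' (giso_Gamma0 iso u)).
  have /choice[W' W'E] : forall u, exists v, Psi v = Psi' u.
    by move=> u; exact: (giso_surj iso (giso_Gamma0 iso' u)).
  have WK : cancel W W' by move=> u; apply: (giso_inj iso); rewrite W'E WE.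
  have W'K : cancel W' W by move=> u; apply: (giso_inj iso'); rewrite WE W'E.
  exists W; split.
    split; first by exists W'.
    - move=> a u v; apply: (iso_ext iso') => z.
      by rewrite WE !(giso_linear iso, giso_linear iso') !WE.
    - by move=> u v x; rewrite [LHS](giso_inner iso') [RHS](giso_inner iso) !WE.
    - move=> u f fC; apply: (iso_ext iso') => z.
      by rewrite WE (giso_ract iso)// (giso_ract iso')// WE.
    - by move=> u g gC; apply: (iso_ext iso') => z; rewrite WE lact1// lact2// WE.
  apply/seteqP; split=> [T [f fC fT]|T [S [f fC fS] TS]].
    (* Conjugation by [W] preserves the function: multiplication by [f] read through [Psi] becomes
       multiplication by the same [f] read through [Psi']. *)
    exists (W' \o T \o W); last by apply/funext => u; rewrite /= W'K.
    by exists f => // u z; rewrite /= W'E fT WE.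
  exists f => // u z; have := congr1 (fun A => A (W' u)) TS.
  by rewrite /= W'K => ->; rewrite WE fS -WE W'K.
Qed.
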